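(* Let $\lambda\vdash n$ be a partition whose $2$-core has size $s=\binom{m+1}{2}$ with $m\ge 0$, and let $p>\max\{2,2m-1\}$ be a prime not dividing $\Delta(n_\lambda)$. Let $\sigma$ be the slope of the right-most edge of the Newton polygon of $R_\lambda(x)$ with respect to $p$. Then: (i) if $m=0$, then $\sigma<\frac{1}{p-1}$, and if moreover $n<p^2$ then $\sigma\le \frac1p$; (ii) if $m\ge 1$, then $\sigma\le \frac{1}{p-(2m-1)}$. Moreover the bound in (ii) is attained: for every $m\ge1$ and every prime $p>\max\{2,2m-1\}$ there is a partition $\lambda$ with $2$-core of size $\binom{m+1}2$ and $p\nmid\Delta(n_\lambda)$ for which $\sigma=\frac{1}{p-(2m-1)}$; and for every prime $p\ge 3$ there is a partition $\lambda$ with empty $2$-core and $p\nmid \Delta(n_\lambda)$ for which $\sigma\ge\frac1p$.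
   Context: $\mathrm{He}_k(x)$ denotes the monic probabilists' Hermite polynomial of degree $k$. A partition $\lambda=(\lambda_1\ge\dots\ge\lambda_r\ge 0)$ may have zero parts; $|\lambda|=\sum\lambda_i$, and $\lambda\vdash n$ means $|\lambda|=n$. Its degree sequence is $n_\lambda=(\lambda_r,\lambda_{r-1}+1,\dots,\lambda_1+r-1)$, and $\Delta(x_1,\dots,x_r)=\prod_{i<j}(x_j-x_i)$. The Wronskian Hermite polynomial is $\mathrm{He}_\lambda(x)=\mathrm{Wr}[\mathrm{He}_{n_1},\dots,\mathrm{He}_{n_r}]/\Delta(n_\lambda)$, monic of degree $|\lambda|$ with integer coefficients. Removing a $2$-hook means replacing an entry $a$ of $n_\lambda$ by $a-2\ge0$ with $a-2\notin n_\lambda$; removing $2$-hooks until impossible yields the $2$-core $\bar\lambda$, a staircase $(m,m-1,\dots,1)$ padded with zeros. $\mathrm{He}_\lambda(x)=x^{|\bar\lambda|}R_\lambda(x)$ with $R_\lambda\in\mathbb{Z}[x]$, $R_\lambda(0)\neq 0$. For $G(x)=\sum_{i=0}^N a_ix^i\in\mathbb{Z}[x]$ with $a_0\neq0$ and a prime $p$, the Newton polygon of $G$ with respect to $p$ is the lower convex hull of the points $(i,\nu_p(a_{N-i}))$, $0\le i\le N$, $a_{N-i}\ne0$, where $\nu_p$ is the $p$-adic valuation; its right-most edge is the edge ending at $(N,\nu_p(a_0))$. *)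

(* Defs.v *)
From HB Require Import structures.
From mathcomp Require Import all_boot all_order all_algebra.
Set Implicit Arguments. Unset Strict Implicit. Unset Printing Implicit Defensive.
Import Order.TTheory GRing.Theory Num.Theory.
Local Open Scope ring_scope.

Fixpoint herm_pair (k : nat) : {poly rat} * {poly rat} :=
  match k with
  | 0%N => (1, 'X)
  | k'.+1 => let: (a, b) := herm_pair k' in (b, 'X * b - (k'.+1)%:R *: a)
  end.
Definition He (k : nat) : {poly rat} := (herm_pair k).1.

(* A partition lambda = (lambda_1 >= ... >= lambda_r >= 0), zero parts allowed;
   r = size lam is part of the data. *)
Definition is_partition (lam : seq nat) : Prop := sorted geq lam.

Definition degseq (lam : seq nat) : seq nat :=
  [seq (nth 0%N lam (size lam - 1 - i) + i)%N | i <- iota 0 (size lam)].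

(* Delta(x_1..x_r) = prod_{i<j} (x_j - x_i); for the (strictly increasing)
   degree sequence all factors are positive, so it is computed in nat. *)
Definition Vdm (x : seq nat) : nat :=
  \prod_(j < size x) \prod_(i < j) (nth 0%N x j - nth 0%N x i)%N.
Definition Delta (lam : seq nat) : nat := Vdm (degseq lam).

Definition Wronskian (fs : seq {poly rat}) : {poly rat} :=
  \det (\matrix_(i < size fs, j < size fs) (derivn i (nth 0 fs j))).

Definition HeW (lam : seq nat) : {poly rat} :=
  ((Delta lam)%:R)^-1 *: Wronskian [seq He k | k <- degseq lam].

(* Removing 2-hooks on degree sequences; reaches2core D C: C is obtained from D
   by successive 2-hook removals and no further removal is possible. *)
Definition remove_at (a : nat) (D : seq nat) : seq nat :=
  [seq (if x == a then (a - 2)%N else x) | x <- D].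
Inductive reaches2core : seq nat -> seq nat -> Prop :=
| core_stop D : (forall a, a \in D -> (2 <= a)%N -> (a - 2)%N \in D) ->
                reaches2core D D
| core_step D a C : a \in D -> (2 <= a)%N -> (a - 2)%N \notin D ->
                reaches2core (remove_at a D) C -> reaches2core D C.

(* size |mu| of the partition with degree sequence D: sum D - binom(r,2) *)
Definition dsize (D : seq nat) : nat := (sumn D - 'C(size D, 2))%N.

Definition core2_size (lam : seq nat) (s : nat) : Prop :=
  exists C, reaches2core (degseq lam) C /\ dsize C = s.

(* R_lambda: He_lambda = x^k R_lambda with R_lambda(0) <> 0 (k = x-adic valuation) *)
Definition xval (G : {poly rat}) : nat := find (fun c => c != 0) G.
Definition Rpoly (lam : seq nat) : {poly rat} := drop_poly (xval (HeW lam)) (HeW lam).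

Definition nu (p : nat) (x : rat) : int :=
  (logn p `|numq x|%N)%:Z - (logn p `|denq x|%N)%:Z.

(* Slope of the right-most edge of the Newton polygon of G = sum a_i x^i
   (a_0 <> 0, N = deg G) w.r.t. p.  The polygon is the lower convex hull of the
   points (i, nu(a_{N-i})), a_{N-i} <> 0; the right-most edge ends at
   (N, nu(a_0)) and its slope is max over the other points (N-k, nu(a_k)),
   1 <= k <= N, a_k <> 0, of (nu(a_0) - nu(a_k)) / k.  (0 if N = 0: no edge.) *)
Definition NPslopes (p : nat) (G : {poly rat}) : seq rat :=
  [seq ((nu p G`_0 - nu p G`_k)%:~R / k%:R : rat)
     | k <- iota 1 (size G).-1 & G`_k != 0].
Definition NPslope (p : nat) (G : {poly rat}) : rat :=
  let L := NPslopes p G in foldr Num.max (head 0 L) L.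

(* Main.v *)
Require Import Defs.
From HB Require Import structures.
From mathcomp Require Import all_boot all_order perm all_algebra.
From mathcomp Require Import zify ring.
Import Order.TTheory GRing.Theory Num.Theory.

(** The coefficients of [He_n] are [U_n B(n,c) / c!], where [U_n] is, up to sign,
    the product of the odd numbers at most [n] and [B] is an integer matrix.
    Expanding the Wronskian by multilinearity, the coefficient of [x^E] becomes
    [prod_j U_(n_j)] times an integer combination of the [1 / H(C)], where [C] runs
    over the sets of [r] naturals with sum [E + r(r-1)/2] and as many odd elements
    as the degree sequence, and [H(C)] is the product of the hook lengths of the
    partition with beta-set [C].  In the lowest coefficient only the beta-set [K]
    of the 2-core contributes; its integer factor is the determinant of a
    generalized Vandermonde matrix, nonzero mod [p] because the degrees are distinct
    mod [p].  So [nu(a_0) - nu(a_k)] is at most the largest [nu(H(C))] with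
    [|C| = s + k].

    [nu(H(C))] is the sum over [l >= 1] of the number [w_l] of hooks divisible by
    [p^l].  Sliding a bead of [C] from [c] to [c - p^l] lowers [w_l] by one and moves
    the number of odd beads by at most one, so [C] has size [p^l w_l] plus that of a
    beta-set whose 2-core is controlled; this bounds every [w_l] in terms of [k].

    The slopes [1/(p-2m+1)] and [1/p] occur at the degree sequences
    [(1, 3, ..., 2m-3, p)] and [(p, p+1)]: there [He_lambda] is monic, which gives
    a point of valuation 0 at the far end of the polygon. *)

Local Open Scope nat_scope.

(** * Hooks of beta-sets *)

(** For a beta-set [s], a bead [c] and a gap [b < c] form a cell of the partition, and [c - b] is
    its hook length. *)
Definition hook_count (P : nat) (s : seq nat) : nat :=
  \sum_(c <- s) \sum_(b < c) (((b : nat) \notin s) && (P %| c - b)).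

Definition hook_prod (s : seq nat) : nat :=
  \prod_(c <- s) \prod_(b < c | (b : nat) \notin s) (c - b).

Lemma big_ord_mem (R : Type) (idx : R) (op : Monoid.com_law idx)
    (s : seq nat) (c : nat) (F : nat -> R) : uniq s ->
  \big[op/idx]_(b < c | (b : nat) \in s) F b = \big[op/idx]_(y <- s | y < c) F y.
Proof.
move=> us; rewrite -(big_mkord (fun b => b \in s)) -big_filter -[RHS]big_filter.
apply/perm_big/uniq_perm; rewrite ?filter_uniq ?iota_uniq // => x.
by rewrite !mem_filter mem_index_iota andbC.
Qed.

Lemma sum_dvd_sub (P c : nat) : 0 < P -> \sum_(b < c) (P %| c - b) = c %/ P.
Proof.
move=> P0; elim: c => [|c IH]; first by rewrite big_ord0 div0n.
rewrite big_ord_recl /= subn0 divnS //; congr (_ + _).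
by rewrite -[RHS]IH; apply: eq_bigr => i _; rewrite subSS.
Qed.

Lemma sum_eqn_uniq (s : seq nat) : uniq s ->
  \sum_(x <- s) \sum_(y <- s) (x == y) = size s.
Proof.
move=> us; rewrite -sum1_size [LHS]big_seq [RHS]big_seq; apply: eq_bigr => x xs.
have -> : 1 = count (pred1 x) s by rewrite count_uniq_mem // xs.
rewrite -sum1_count [RHS]big_mkcond /=; apply: eq_bigr => y _.
by rewrite eq_sym; case: eqP.
Qed.

(** The quotient [c %/ P] counts every [b < c] congruent to [c]: the gaps among them go to
    [hook_count], the beads to [A]. Ordered congruent pairs of beads number [2 A] plus the diagonal.
    Thus the number of hooks is determined by quotients and residues alone. *)
Lemma hook_count_eq (P : nat) (s : seq nat) : 0 < P -> uniq s ->
  2 * hook_count P s + \sum_(x <- s) \sum_(y <- s) (x == y %[mod P])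
  = 2 * (\sum_(x <- s) x %/ P) + size s.
Proof.
move=> P0 us.
pose A := \sum_(x <- s) \sum_(y <- s) ((y < x) && (P %| x - y)).
have E1 : \sum_(x <- s) x %/ P = hook_count P s + A.
  rewrite -big_split /=; apply: eq_bigr => c _.
  rewrite -(sum_dvd_sub _ _ P0).
  have -> : \sum_(y <- s) ((y < c) && (P %| c - y)) =
            \sum_(b < c | (b : nat) \in s) (P %| c - b).
    rewrite (big_ord_mem _ _ _ _ _ (fun b => nat_of_bool (P %| c - b)) us) [RHS]big_mkcond.
    by apply: eq_bigr => y _; case: (y < c).
  rewrite [X in _ + X]big_mkcond -big_split /=; apply: eq_bigr => b _.
  by case: (_ \in s) => //=; case: (P %| _).
have E2 : \sum_(x <- s) \sum_(y <- s) (x == y %[mod P]) = A + A + size s.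
  have A' : A = \sum_(x <- s) \sum_(y <- s) ((x < y) && (P %| y - x)).
    by rewrite /A exchange_big.
  rewrite -(sum_eqn_uniq _ us) {2}A' /A -!big_split /=.
  apply: eq_bigr => x _; rewrite -!big_split /=; apply: eq_bigr => y _.
  have [xy|xy|->] := ltngtP x y; last by rewrite eqxx.
  - by rewrite eq_sym eqn_mod_dvd 1?ltnW //; case: (P %| _).
  - by rewrite eqn_mod_dvd 1?ltnW //; case: (P %| _).
by rewrite E1 E2; lia.
Qed.

(** For [P = 2] this is convertible with [remove_at], so the lemmas on slides apply to
    [reaches2core]. *)
Definition slide (P a : nat) (s : seq nat) : seq nat :=
  [seq (if x == a then a - P else x) | x <- s].

Lemma slide_inj (P a : nat) (s : seq nat) : a - P \notin s ->
  {in s &, injective (fun x => if x == a then a - P else x)}.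
Proof.
move=> n x y xs ys; case: eqP => [->|_]; case: eqP => [->|_] // E.
  by rewrite E ys in n.
by rewrite -E xs in n.
Qed.

Lemma slide_uniq (P a : nat) (s : seq nat) :
  uniq s -> a - P \notin s -> uniq (slide P a s).
Proof. by move=> us n; rewrite map_inj_in_uniq //; apply: slide_inj. Qed.

Lemma sum_slide (P a : nat) (s : seq nat) (F : nat -> nat) : uniq s -> a \in s ->
  \sum_(x <- slide P a s) F x + F a = \sum_(x <- s) F x + F (a - P).
Proof.
move=> us as_; rewrite big_map (bigD1_seq a) //= [in RHS](bigD1_seq a) //= eqxx.
have -> : \sum_(x <- s | x != a) F (if x == a then a - P else x) = \sum_(x <- s | x != a) F x.
  by apply: eq_bigr => x /negPf ->.
lia.
Qed.

(** A slide keeps all residues mod [P] and lowers the sum of the quotients by one; [hook_count_eq]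
    then removes exactly one hook. *)
Lemma hook_count_slide (P a : nat) (s : seq nat) : 0 < P -> uniq s -> a \in s ->
  P <= a -> a - P \notin s -> hook_count P s = (hook_count P (slide P a s)).+1.
Proof.
move=> P0 us as_ Pa n.
have := hook_count_eq P (slide P a s) P0 (slide_uniq _ _ _ us n).
have := hook_count_eq P s P0 us.
have := sum_slide P a s (fun x => x %/ P) us as_.
have -> : \sum_(x <- slide P a s) \sum_(y <- slide P a s) (x == y %[mod P]) =
          \sum_(x <- s) \sum_(y <- s) (x == y %[mod P]).
  rewrite big_map; apply: eq_bigr => x _; rewrite big_map; apply: eq_bigr => y _.
  have E z : (if z == a then a - P else z) = z %[mod P].
    by case: eqP => [->|] //; rewrite -[in RHS](subnK Pa) modnDr.
  by rewrite !E.
have -> : a %/ P = (a - P) %/ P + 1.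
  by rewrite -{1}(subnK Pa) divnDr ?dvdnn // divnn P0.
rewrite size_map.
set Q := \sum_(x <- s) \sum_(y <- s) _; set B := (a - P) %/ P; set A' := \sum_(x <- slide _ _ _) _.
set A := \sum_(x <- s) x %/ P; set h := hook_count _ s; set h' := hook_count _ _.
clearbody Q B A A' h h'; move: (size s) => z; lia.
Qed.

(** Descending from the bead [c] to the gap [b] in steps of [P], the last bead before the first gap
    met can slide. *)
Lemma hook_count_gt0 (P : nat) (s : seq nat) : 0 < P -> 0 < hook_count P s ->
  exists2 a, a \in s & P <= a /\ a - P \notin s.
Proof.
move=> P0 h.
have [c cs [b bc [bs dv]]] :
    exists2 c, c \in s & exists2 b, b < c & b \notin s /\ P %| c - b.
  have : has (fun c => [exists b : 'I_c, ((b : nat) \notin s) && (P %| c - b)]) s.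
    apply/negPn/negP => /hasPn nh; suff : hook_count P s = 0 by lia.
    rewrite /hook_count big_seq big1 // => c cs; apply: big1 => b _.
    by have := nh c cs; rewrite negb_exists => /forallP/(_ b)/negPf ->.
  case/hasP => c cs /existsP[b /andP[bs dv]]; exists c => //; exists (val b) => //; apply: ltn_ord.
case/dvdnP: dv => t; elim: t c cs bc => [|t IH] c cs bc E; first by lia.
have Pc : P <= c by rewrite mulSn in E; lia.
case: (boolP (c - P \in s)) => cP; last by exists c.
have E' : c - P - b = t * P by rewrite mulSn in E; lia.
have [E0|ne] := eqVneq (c - P) b; first by rewrite E0 (negPf bs) in cP.
apply: (IH (c - P)) => //; rewrite mulSn in E; lia.
Qed.

Lemma sum_mod2 (s : seq nat) :
  \sum_(x <- s) \sum_(y <- s) (x == y %[mod 2]) =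
  count odd s ^ 2 + count (predC odd) s ^ 2.
Proof.
have E x : \sum_(y <- s) (x == y %[mod 2]) = if odd x then count odd s else count (predC odd) s.
  rewrite -!sum1_count; case: (boolP (odd x)) => ox; rewrite [RHS]big_mkcond;
  apply: eq_bigr => y _; rewrite !modn2 /=; move: ox; by case: (odd x) (odd y) => [] [].
rewrite (eq_bigr _ (fun x _ => E x)).
rewrite (bigID odd) /= (eq_bigr (fun=> count odd s)) => [|x ->] //.
rewrite [X in _ + X](eq_bigr (fun=> count (predC odd) s)) => [|x /negPf->] //.
by rewrite !big_const_seq !iter_addn_0 -!mulnn; congr (_ + _); rewrite mulnC.
Qed.

(** This is [hook_count_eq] at [P = 2]. The last two terms are the sum of the beta-set of the
    2-core, so each even hook contributes 2 beyond the core. *)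
Lemma sum_hook2 (s : seq nat) : uniq s ->
  \sum_(x <- s) x = 2 * hook_count 2 s + count (predC odd) s * (count (predC odd) s).-1
     + count odd s ^ 2.
Proof.
move=> us; have := hook_count_eq 2 s isT us; rewrite sum_mod2.
have -> : \sum_(x <- s) x = 2 * (\sum_(x <- s) x %/ 2) + count odd s.
  rewrite -sum1_count big_distrr /= [X in _ + X]big_mkcond -big_split /=.
  by apply: eq_bigr => x _; rewrite {1}(divn_eq x 2) modn2 mulnC; case: (odd x).
rewrite -(count_predC odd s); case: (count (predC odd) s) => [|e] /=; nia.
Qed.

(** The set [t] is what remains after [hook_count P s] successive slides. Each slide lowers the sum
    by [P] and moves a single bead, hence changes the number of odd beads by at most one. *)
Lemma hook_reduce (P : nat) (s : seq nat) : odd P -> uniq s ->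
  exists t, [/\ uniq t, size t = size s,
    \sum_(x <- s) x = P * hook_count P s + \sum_(x <- t) x,
    count odd s <= count odd t + hook_count P s &
    count odd t <= count odd s + hook_count P s].
Proof.
move=> oP; have P0 : 0 < P by case: P oP.
move hw: (hook_count P s) => w; elim: w s hw => [|w IH] s hw us.
  by exists s; split; rewrite ?muln0 ?addn0.
case: (hook_count_gt0 P s P0) => [|a as_ [Pa n]]; first by rewrite hw.
have := hook_count_slide P a s P0 us as_ Pa n; rewrite hw => -[hw'].
have [t [ut st E h1 h2]] := IH _ (esym hw') (slide_uniq _ _ _ us n).
have := sum_slide P a s id us as_; rewrite /= E => Es.
have := sum_slide P a s (fun x => nat_of_bool (odd x)) us as_.
have C u : \sum_(x <- u) odd x = count odd u.
  by elim: u => [|x u IHu]; rewrite ?big_nil // big_cons IHu.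
rewrite !C => Ec; exists t; rewrite size_map in st; split => //.
- by rewrite mulnS; move: Es; move: (\sum_(x <- s) _) (\sum_(x <- t) _) => X Y; lia.
- by case: (odd a) Ec; case: (odd (a - P)) => /= Ec; lia.
- by case: (odd a) Ec; case: (odd (a - P)) => /= Ec; lia.
Qed.

(** * Valuation of the hook product *)

Lemma logn_prod_gt0 (p : nat) (I : Type) (r : seq I) (P : pred I) (F : I -> nat) :
  (forall i, P i -> 0 < F i) ->
  logn p (\prod_(i <- r | P i) F i) = \sum_(i <- r | P i) logn p (F i).
Proof.
move=> F0; elim: r => [|i r IH]; first by rewrite !big_nil logn1.
rewrite !big_cons; case: ifP => // Pi.
by rewrite lognM ?IH ?F0 // prodn_cond_gt0.
Qed.

Lemma logn_dvd_sum (p n M : nat) : prime p -> 0 < n -> n <= M ->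
  logn p n = \sum_(1 <= l < M) (p ^ l %| n).
Proof.
move=> pp n0 nM; rewrite (big_cat_nat n0 nM) /= -logn_count_dvd //.
rewrite [X in _ + X]big_nat_cond [X in _ + X]big1 ?addn0 // => l /andP[/andP[nl _] _].
apply/eqP; rewrite eqb0; apply/negP => /dvdn_leq; move/(_ n0).
by apply/negP; rewrite -ltnNge (leq_ltn_trans nl) // ltn_expl // prime_gt1.
Qed.

Lemma logn_hook_prod (p : nat) (s : seq nat) (M : nat) : prime p ->
  {in s, forall c, c <= M} ->
  logn p (hook_prod s) = \sum_(1 <= l < M) hook_count (p ^ l) s.
Proof.
move=> pp sM; rewrite /hook_prod /hook_count logn_prod_gt0; last first.
  by move=> c _; apply: prodn_cond_gt0 => b _; rewrite subn_gt0.
rewrite exchange_big [LHS]big_seq [RHS]big_seq /=; apply: eq_bigr => c cs.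
rewrite exchange_big logn_prod_gt0 => [|b _]; last by rewrite subn_gt0.
rewrite big_mkcond; apply: eq_bigr => b _.
case: (_ \notin s) => /=; last by rewrite big1.
by apply: logn_dvd_sum; rewrite ?subn_gt0 // (leq_trans (leq_subr _ _)) ?sM.
Qed.

Lemma hook_prod_gt0 (s : seq nat) : 0 < hook_prod s.
Proof. by apply: prodn_cond_gt0 => c _; apply: prodn_cond_gt0 => b _; rewrite subn_gt0. Qed.

Lemma sum_div_exp_lt (p k M : nat) : 0 < p -> 0 < k ->
  p.-1 * (\sum_(1 <= l < M) k %/ p ^ l) < k.
Proof.
(* The bound telescopes, since [p.-1] times the next quotient is at most the drop between
   consecutive quotients; the maximum with 1 keeps the strictness once the quotients reach 0. *)
move=> p0 k0; suff : p.-1 * (\sum_(1 <= l < M.+1) k %/ p ^ l) + maxn (k %/ p ^ M) 1 <= k.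
  have : \sum_(1 <= l < M) k %/ p ^ l <= \sum_(1 <= l < M.+1) k %/ p ^ l.
    case: M => [|M]; first by rewrite big_geq.
    by rewrite [leqRHS]big_nat_recr //= leq_addr.
  move/(leq_mul (leqnn p.-1)) => h1 h2; apply: leq_ltn_trans h1 _.
  by apply: leq_trans h2; rewrite -addn1 leq_add2l leq_maxr.
elim: M => [|M IH]; first by rewrite big_geq // muln0 expn0 divn1; lia.
rewrite big_nat_recr //=; move: IH.
have := leq_trunc_div (k %/ p ^ M) p; rewrite -divnMA -expnSr.
move: (\sum_(1 <= l < M.+1) _) (k %/ p ^ M) (k %/ p ^ M.+1) => S a b; nia.
Qed.

(** The 2-core with [e] even and [o] odd beads has beta-set 0, 2, ..., 2e-2 and 1, 3, ..., 2o-1,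
    with sum [e (e-1) + o^2]. Subtracting ['C(size s, 2)] gives the size of the core. *)
Definition core_sum (s : seq nat) : nat :=
  count (predC odd) s * (count (predC odd) s).-1 + count odd s ^ 2.

Lemma mul2_bin2 (n : nat) : 2 * 'C(n.+1, 2) = n.+1 * n.
Proof. by elim: n => // n IH; rewrite binS bin1 mulnDr IH; lia. Qed.

(** The reduced set of [hook_reduce] has the same number of distinct elements, so its sum is still
    at least ['C(size s, 2)]. *)
Lemma hook_count_le (P : nat) (s : seq nat) : odd P -> uniq s ->
  P * hook_count P s + 'C(size s, 2) <= \sum_(x <- s) x.
Proof.
move=> oP us; have [t [ut st -> _ _]] := hook_reduce P s oP us.
rewrite leq_add2l (sum_hook2 _ ut) -st -(count_predC odd t).
move: (count odd t) (count (predC odd) t) => o e.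
apply: (@leq_trans (e * e.-1 + o ^ 2)); last by rewrite -addnA leq_addl.
rewrite -(@leq_pmul2l 2) //; case E : (o + e) => [|n] //; rewrite mul2_bin2.
case: e E => [|e] /= E; first nia.
have {E} -> : n = o + e by lia.
by have [/subnKC <-|/subnKC <-] := leqP o e; nia.
Qed.

(** With [d = o - e], the 2-core has size [d (d+1) / 2], so [d] is [m] or [-(m+1)]. After [h] slides
    the number of odd beads has changed by some [x <= h], which shifts [d] by [2x] in either
    direction. In the worse direction the core loses [2mx - 2x^2 + x], at most [(2m-1) h]; in the
    other it does not shrink. *)
Lemma hook_count_core_le (P m : nat) (s : seq nat) : odd P -> uniq s -> 0 < m ->
  core_sum s = 'C(size s, 2) + 'C(m.+1, 2) ->
  P.+1 * hook_count P s + 'C(m.+1, 2) + 'C(size s, 2) <=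
  \sum_(x <- s) x + 2 * m * hook_count P s.
Proof.
move=> oP us m0 cs; have [t [ut st -> h1 h2]] := hook_reduce P s oP us.
move: cs; rewrite (sum_hook2 _ ut) /core_sum.
have := count_predC odd s; have := count_predC odd t; rewrite st.
move: h1 h2; move: (hook_count P s) (hook_count 2 t) (size s) => h h' z.
move: (count odd s) (count odd t) (count (predC odd) s) (count (predC odd) t) => o o' e e'.
move=> h1 h2 E1 E2 cs.
suff : P.+1 * h + 'C(m.+1, 2) + 'C(z, 2) <= P * h + (e' * e'.-1 + o' ^ 2) + 2 * m * h.
  nia.
rewrite mulSn.
have Ez : 2 * 'C(z, 2) + z = z * z by case: z {E1 E2 cs} => // z; rewrite mul2_bin2; nia.
have Em := mul2_bin2 m.
have Ee : e * e.-1 + e = e * e by case: (e) => // ?; rewrite /=; nia.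
have Ee' : e' * e'.-1 + e' = e' * e' by case: (e') => // ?; rewrite /=; nia.
move: cs Ez Em Ee Ee'; move: (e * _) (e' * _) ('C(z, 2)) ('C(m.+1, 2)) => X X' Z Y.
rewrite -!mulnn => cs Ez Em Ee Ee'.
have hm : h <= m * h by rewrite leq_pmull.
suff : 2 * Y + 2 * h + 2 * Z <= 2 * (X' + o' * o') + 4 * (m * h) by lia.
have eqm d : d * d.+1 = m * m.+1 -> d = m.
  by move=> H; case: (ltngtP d m) => // dm; nia.
(* [xx] and [mxh] are [x <= x^2] and [(m-1) x <= (m-1) h] written without subtraction; together with
   [x <= h] they bound the loss [2mx - 2x^2 + x] by [(2m-1) h]. *)
have xx x : x <= x * x by case: x => // x; rewrite leq_pmull.
have mxh x : x <= h -> m * x + h <= m * h + x.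
  move=> xh; case: (m) m0 => // m' _; have := leq_mul (leqnn m') xh; lia.
have [eo|oe] := leqP e o.
  have [d Ho] : exists d, o = e + d by exists (o - e); lia.
  have Hd : d = m by apply: eqm; subst; lia.
  have [oo'|o'o] := leqP o o'.
    have [x Hx] : exists x, o' = o + x by exists (o' - o); lia.
    have He : e = e' + x by lia.
    subst; lia.
  have [x Hx] : exists x, o = o' + x by exists (o - o'); lia.
  have He : e' = e + x by lia.
  have xh' : m * x + h <= m * h + x by apply: mxh; lia.
  have := xx x; subst; lia.
have [d Ho] : exists d, e = o + d.+1 by exists (e - o).-1; lia.
have Hd : d = m by apply: eqm; subst; lia.
have [oo'|o'o] := leqP o o'.
  have [x Hx] : exists x, o' = o + x by exists (o' - o); lia.
  have He : e = e' + x by lia.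
  have xh' : m * x + h <= m * h + x by apply: mxh; lia.
  have := xx x; subst; lia.
have [x Hx] : exists x, o = o' + x by exists (o - o'); lia.
have He : e' = e + x by lia.
subst; lia.
Qed.

Lemma hook_count_le_div (P k : nat) (s : seq nat) : odd P -> uniq s ->
  \sum_(x <- s) x = 'C(size s, 2) + k -> hook_count P s <= k %/ P.
Proof.
move=> oP us E; rewrite leq_divRL; last by case: P oP.
by have := hook_count_le P s oP us; rewrite E mulnC; lia.
Qed.

(** The cut-off exceeds every bead, and [.+2] makes sure that the range contains [l = 1], so that
    this term can be split off. *)
Lemma logn_hook_prod_sum (p : nat) (s : seq nat) : prime p ->
  logn p (hook_prod s) =
  \sum_(1 <= l < (\sum_(x <- s) x).+2) hook_count (p ^ l) s.
Proof.
move=> pp; apply: logn_hook_prod => // c cs.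
by rewrite (big_rem c) //=; lia.
Qed.

Lemma logn_hook_prod_lt (p k : nat) (s : seq nat) : prime p -> odd p -> uniq s ->
  \sum_(x <- s) x = 'C(size s, 2) + k -> 0 < k ->
  p.-1 * logn p (hook_prod s) < k.
Proof.
move=> pp op us E k0; rewrite logn_hook_prod_sum //.
apply: leq_ltn_trans (sum_div_exp_lt p k _ (prime_gt0 pp) k0).
rewrite leq_mul2l; apply/orP; right; apply: leq_sum => l _.
by apply: hook_count_le_div; rewrite ?oddX ?op ?orbT.
Qed.

Lemma logn_hook_prod1 (p : nat) (s : seq nat) : prime p ->
  (forall l, 2 <= l -> hook_count (p ^ l) s = 0) ->
  logn p (hook_prod s) = hook_count p s.
Proof.
move=> pp h; rewrite logn_hook_prod_sum // big_ltn // expn1.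
by rewrite big_nat_cond big1 ?addn0 // => l /andP[/andP[l2 _] _]; apply: h.
Qed.

Lemma logn_hook_prod_small (p k : nat) (s : seq nat) : prime p -> odd p -> uniq s ->
  \sum_(x <- s) x = 'C(size s, 2) + k -> k < p ^ 2 ->
  p * logn p (hook_prod s) <= k.
Proof.
move=> pp op us E kp; rewrite logn_hook_prod1 // => [|l l2].
  by have := hook_count_le p s op us; rewrite E; lia.
apply/eqP; rewrite -leqn0; apply: leq_trans (hook_count_le_div _ _ _ _ us E) _.
  by rewrite oddX op orbT.
by rewrite leqn0 divn_small // (leq_trans kp) // leq_exp2l // prime_gt1.
Qed.

Lemma logn_hook_prod_core (p m k : nat) (s : seq nat) : prime p -> odd p -> uniq s ->
  0 < m -> 2 * m < p -> core_sum s = 'C(size s, 2) + 'C(m.+1, 2) ->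
  \sum_(x <- s) x = core_sum s + k ->
  (p.+1 - 2 * m) * logn p (hook_prod s) <= k.
Proof.
move=> pp op us m0 mp cs E.
have wl l : 0 < l -> ((p ^ l).+1 - 2 * m) * hook_count (p ^ l) s <= k.
  move=> l0; have := hook_count_core_le (p ^ l) m s; rewrite oddX op orbT E cs.
  by move=> /(_ isT us m0 erefl); rewrite mulnBl; lia.
(* If no hook is divisible by [p ^ 2], the valuation equals [hook_count p s] and [wl 1]
   concludes. *)
have [/hasP[l]|/hasPn small] := boolP (has (fun l => 0 < hook_count (p ^ l) s)
    (index_iota 2 (\sum_(x <- s) x).+2)); last first.
  rewrite logn_hook_prod_sum // big_ltn // big_nat big1 ?addn0.
    by have := wl 1; rewrite expn1; apply.
  by move=> l l2; have := small l; rewrite mem_index_iota l2 lt0n negbK => /(_ isT)/eqP.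
rewrite mem_index_iota => /andP[l2 _] hl.
(* A hook divisible by [p ^ 2] makes [k] so large that the cruder Legendre-type bound
   [logn_hook_prod_lt] suffices. *)
have kbig : p ^ 2 - p <= k.
  have h1 := wl l (ltnW l2); have h2 : p ^ 2 <= p ^ l by rewrite leq_exp2l // prime_gt1.
  apply: leq_trans h1; apply: leq_trans (leq_pmulr _ hl); lia.
have : p.-1 * logn p (hook_prod s) < 'C(m.+1, 2) + k.
  apply: logn_hook_prod_lt => //; first by rewrite E cs addnA.
  by rewrite addn_gt0 bin_gt0 /= ltnS m0.
move: kbig; rewrite -mulnn; have := mul2_bin2 m.
move: ('C(m.+1, 2)) (logn _ _) => Y L EY kbig hL.
have hp : 0 < p.-1 by lia.
rewrite -(leq_pmul2l hp) mulnCA.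
case: m m0 mp EY {cs wl} => // m _ mp EY.
have {hL} : (p.+1 - 2 * m.+1) * (p.-1 * L) <= (p.+1 - 2 * m.+1) * (Y.-1 + k).
  by rewrite leq_mul2l; lia.
move=> h; apply: leq_trans h _.
(* Write [q] for [p.+1 - 2 * m.+1]. Since [p.-1 = q + 2 m], what remains is [q (Y - 1) <= 2 m k],
   and [2 (Y - 1) = m (m + 3)] reduces it to [h3]. *)
have -> : p.-1 = (p.+1 - 2 * m.+1) + 2 * m by lia.
rewrite mulnDr mulnDl addnC leq_add2l.
have HY : 2 * Y.-1 = m * (m + 3) by lia.
have h3 : (p.+1 - 2 * m.+1) * (m + 3) <= 4 * k.
  have : (p.+1 - 2 * m.+1) * (m + 3) <= p.-1 * (p + 3) by apply: leq_mul; lia.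
  move=> h; apply: leq_trans h _.
  have : p.-1 * (p + 3) <= p.-1 * (4 * p) by apply: leq_mul; lia.
  have : p.-1 * p = p * p - p by case: (p) => // q; rewrite /=; lia.
  lia.
have := leq_mul (leqnn m) h3; lia.
Qed.

Local Open Scope ring_scope.

(** * p-adic valuations of rationals *)

Lemma nu_frac (p : nat) (a b : int) : a != 0 -> b != 0 ->
  nu p (a%:~R / b%:~R) = (logn p `|a|%N)%:Z - (logn p `|b|%N)%:Z.
Proof.
move=> a0 b0; set x := _ / _.
have x0 : x != 0 by rewrite mulf_neq0 ?invr_eq0 ?intr_eq0.
have E : numq x * b = a * denq x.
  apply/eqP; rewrite -(eqr_int rat) !rmorphM /=
    -[X in _ == X * _](divfK (_ : b%:~R != 0 :> rat)) ?intr_eq0 //.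
  rewrite -/x -[X in _ == X * _ * _]divq_num_den -mulrA [b%:~R * _]mulrC mulrA divfK //.
  by rewrite intr_eq0 denq_neq0.
have := congr1 (fun z : int => logn p `|z|%N) E; rewrite /= !abszM.
rewrite !lognM ?absz_gt0 ?denq_neq0 ?numq_eq0 // /nu; lia.
Qed.

Lemma nuM (p : nat) (x y : rat) : x != 0 -> y != 0 -> nu p (x * y) = nu p x + nu p y.
Proof.
move=> x0 y0; rewrite -[in LHS](divq_num_den x) -[in LHS](divq_num_den y) mulf_div -!rmorphM /=.
rewrite nu_frac ?mulf_neq0 ?numq_eq0 ?denq_neq0 // !abszM !lognM ?absz_gt0 ?numq_eq0 ?denq_neq0 //.
rewrite /nu; move: (logn p _) (logn p _) (logn p _) (logn p _) => *; lia.
Qed.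

Lemma nu_int (p : nat) (a : int) : a != 0 -> nu p a%:~R = (logn p `|a|%N)%:Z.
Proof. by move=> a0; rewrite -[a%:~R]divr1 -[1]/(1%:~R) nu_frac // logn1 subr0. Qed.

Lemma nu_nat (p n : nat) : (0 < n)%N -> nu p n%:R = (logn p n)%:Z.
Proof. by move=> n0; rewrite -[n%:R]/(n%:~R) nu_int //; lia. Qed.

Lemma nu1 (p : nat) : nu p 1 = 0.
Proof. by rewrite -[1]/(1%:R) nu_nat // logn1. Qed.

Lemma nuV (p : nat) (x : rat) : x != 0 -> nu p x^-1 = - nu p x.
Proof.
by move=> x0; have := nuM p x^-1 x; rewrite mulVf // nu1 invr_eq0 x0 => /(_ isT isT); lia.
Qed.

Lemma nuN (p : nat) (x : rat) : nu p (- x) = nu p x.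
Proof. by rewrite /nu numqN denqN abszN. Qed.

Lemma nu_prod (p : nat) (I : finType) (F : I -> rat) : (forall i, F i != 0) ->
  nu p (\prod_i F i) = \sum_i nu p (F i).
Proof.
move=> F0; have : (\prod_i F i != 0) /\ nu p (\prod_i F i) = \sum_i nu p (F i); last by case.
elim/big_rec2: _ => [|i x y _ [y0 <-]]; first by rewrite oner_eq0 nu1.
by rewrite mulf_neq0 // nuM.
Qed.

(* Membership in the localization Z_(p). *)
Definition pint (p : nat) (x : rat) : Prop :=
  exists b : nat, exists a : int, ~~ (p %| b)%N /\ x * b%:R = a%:~R.

Lemma pint_intr (p : nat) (a : int) : prime p -> pint p a%:~R.
Proof. by move=> pp; exists 1%N, a; rewrite mulr1 gtnNdvd // prime_gt1. Qed.

Lemma pintD (p : nat) (x y : rat) : prime p -> pint p x -> pint p y -> pint p (x + y).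
Proof.
move=> pp [b [a [pb E]]] [b' [a' [pb' E']]]; exists (b * b')%N, (a * b'%:Z + a' * b%:Z).
split; first by rewrite Euclid_dvdM // negb_or pb.
rewrite rmorphD !rmorphM /= -E -E' -!pmulrn; ring.
Qed.

Lemma pintM (p : nat) (x y : rat) : prime p -> pint p x -> pint p y -> pint p (x * y).
Proof.
move=> pp [b [a [pb E]]] [b' [a' [pb' E']]]; exists (b * b')%N, (a * a').
split; first by rewrite Euclid_dvdM // negb_or pb.
rewrite !rmorphM /= -E -E'; ring.
Qed.

Lemma pint_sum (p : nat) (I : Type) (r : seq I) (P : pred I) (F : I -> rat) :
  prime p -> (forall i, P i -> pint p (F i)) -> pint p (\sum_(i <- r | P i) F i).
Proof.
move=> pp h; elim/big_rec: _ => [|i x Pi px]; first exact: (pint_intr p 0).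
by apply: pintD => //; apply: h.
Qed.

Lemma pint_div (p m h : nat) : prime p -> (0 < h)%N -> (logn p h <= logn p m)%N ->
  pint p (m%:R / h%:R).
Proof.
move=> pp h0 le; have [q qp] : exists2 q, coprime p q & (h = p ^ logn p h * q)%N.
  have [q pq E] := pfactor_coprime pp h0; exists q => //; lia.
move=> E; have pq : ~~ (p %| q)%N by rewrite -prime_coprime.
have /dvdnP[t Et] : (p ^ logn p h %| m)%N.
  by apply: dvdn_trans (pfactor_dvdnn p m); rewrite dvdn_exp2l.
have q0 : (q != 0)%N by apply: contraNneq pq => ->; rewrite dvdn0.
exists q, t%:Z; split => //; rewrite Et {2}E !natrM.
have ph0 : (p ^ logn p h)%:R != 0 :> rat by rewrite pnatr_eq0 expn_eq0 negb_and -lt0n prime_gt0.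
have qr0 : q%:R != 0 :> rat by rewrite pnatr_eq0.
by rewrite -[RHS]/(t%:R); field; rewrite ph0 qr0.
Qed.

Lemma pint_nu (p : nat) (x : rat) : prime p -> x != 0 -> pint p x -> 0 <= nu p x.
Proof.
move=> pp x0 [b [a [pb E]]].
have b0 : (0 < b)%N by case: b pb {E} => //; rewrite dvdn0.
have b0' : b%:R != 0 :> rat by rewrite pnatr_eq0 -lt0n.
have a0 : a != 0 by rewrite -(intr_eq0 rat) -E mulf_neq0.
have := congr1 (nu p) E; rewrite nuM // nu_nat // nu_int //.
have -> : logn p b = 0%N by rewrite lognE (negPf pb) !andbF.
lia.
Qed.

(** * Coefficients of Hermite polynomials *)

Lemma He_rec (n : nat) : He n.+2 = 'X * He n.+1 - (n.+1)%:R *: He n.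
Proof.
have pair2 k : (herm_pair k).2 = He k.+1 by rewrite /He /=; case: (herm_pair k).
by rewrite -pair2 /= -pair2 /He; case: (herm_pair n).
Qed.

(* [He_n = U_n * sum_c B(n,c) x^c / c!] with [B] an integer matrix *)
Definition oddfact (n : nat) : nat := \prod_(i < n.+1 | odd i) i.
Definition herm_unit (n : nat) : rat := (-1) ^+ n./2 * (oddfact n)%:R.
Definition herm_int (n c : nat) : int :=
  if odd n == odd c then (-2) ^+ c./2 * (n./2 ^_ c./2)%:Z else 0.

Lemma oddfactS (n : nat) :
  oddfact n.+1 = (oddfact n * (if odd n.+1 then n.+1 else 1))%N.
Proof. by rewrite /oddfact big_mkcond big_ord_recr /= -big_mkcond. Qed.

Lemma oddfact_gt0 (n : nat) : (0 < oddfact n)%N.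
Proof. by apply: prodn_cond_gt0 => -[[|i]]. Qed.

Lemma herm_unit_neq0 (n : nat) : herm_unit n != 0.
Proof. by rewrite mulf_neq0 ?signr_eq0 // pnatr_eq0 -lt0n oddfact_gt0. Qed.

Lemma herm_unit_even (h : nat) : herm_unit h.*2.+1 = (h.*2.+1)%:R * herm_unit h.*2.
Proof.
by rewrite /herm_unit oddfactS /= odd_double /= uphalf_double doubleK natrM; ring.
Qed.

Lemma herm_unit_odd (h : nat) : herm_unit h.*2.+2 = - herm_unit h.*2.+1.
Proof.
rewrite /herm_unit oddfactS /= odd_double /= uphalf_double doubleK muln1 exprS; ring.
Qed.

Lemma ffact_pascal (h g : nat) : (h.+1 ^_ g.+1 = h ^_ g.+1 + g.+1 * h ^_ g)%N.
Proof.
rewrite ffactSS ffactnSr; have [gh|hg] := leqP g h; last first.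
  by rewrite ffact_small // !muln0.
by rewrite mulnC -[in RHS](mulnC (h ^_ g)) -mulnDr; congr (_ * _)%N; lia.
Qed.

(** Once [c!] is cleared, the three-term recurrence becomes an identity between falling factorials:
    Pascal's rule [ffact_pascal] when the new index is even, and the identity [key] below when it is
    odd. *)
Lemma coef_He (n c : nat) : (He n)`_c = herm_unit n * (herm_int n c)%:~R / c`!%:R.
Proof.
have f0 k : k`!%:R != 0 :> rat by rewrite pnatr_eq0 -lt0n fact_gt0.
suff : (He n)`_c * c`!%:R = herm_unit n * (herm_int n c)%:~R.
  by move=> <-; rewrite mulfK.
elim/ltn_ind: n c => -[|[|n]] IH c.
- rewrite /He /= coefC /herm_unit /herm_int /oddfact big_mkcond big_ord1 /= mul1r.
  case: c => [|[|c]] //=; rewrite ?mul0r ?mul1r // ffact0n mulr0.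
  by case: ifP.
- rewrite /He /= coefX /herm_unit /herm_int /oddfact big_mkcond !big_ord_recr big_ord0 /= !mul1r.
  case: c => [|[|c]] //=; rewrite ?mul0r ?mul1r // ffact0n mulr0.
  by case: ifP.
rewrite He_rec coefB coefZ coefXM mulrBl -mulrA IH //.
have -> : (if c == 0%N then 0 else (He n.+1)`_c.-1) * c`!%:R =
          c%:R * (herm_unit n.+1 * (herm_int n.+1 c.-1)%:~R).
  case: c => [|c] /=; first by rewrite !mul0r.
  by rewrite -IH // factS natrM; ring.
have [h [->|->]] : exists h, n = h.*2 \/ n = h.*2.+1.
  exists n./2; have := odd_double_half n; case: (odd n) => /= E; [right|left]; lia.
- rewrite herm_unit_odd herm_unit_even /herm_int /= odd_double /= uphalf_double doubleK.
  case: c => [|c] /=; first by rewrite !ffactn0; ring.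
  case: (boolP (odd c)) => oc /=; last by ring.
  have -> : uphalf c = (c./2).+1 by rewrite uphalf_half oc.
  have cE : c.+1%:R = 2 * (c./2.+1)%:R :> rat.
    by rewrite -(natrM _ 2) -[in LHS](odd_double_half c) oc; congr _%:R; lia.
  rewrite ffact_pascal cE !PoszD !PoszM !(rmorphD, rmorphM, rmorphXn) /= exprS.
  ring.
- have u3 : herm_unit h.*2.+3 = - (h.*2.+3%:R * (h.*2.+1%:R * herm_unit h.*2)).
    by rewrite -doubleS herm_unit_even doubleS herm_unit_odd herm_unit_even mulrN.
  rewrite u3 herm_unit_odd herm_unit_even /herm_int /= odd_double /= !uphalf_double doubleK.
  case: c => [|c] /=; first by ring.
  case: (boolP (odd c)) => oc /=; first by ring.
  have -> : uphalf c = (c./2) by rewrite uphalf_half (negPf oc).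

  have cE : c.+1%:R = 2 * (c./2)%:R + 1 :> rat.
    by rewrite -(natrM _ 2) -natr1 -[in LHS](odd_double_half c) (negPf oc); congr (_%:R + 1); lia.
  have hE : (h.*2.+1)%:R = 2 * h%:R + 1 :> rat
    by rewrite -natr1 -(natrM _ 2); congr (_%:R + 1); lia.
  have hE2 : (h.*2.+3)%:R = 2 * h%:R + 3 :> rat by rewrite -(natrM _ 2) -natrD; congr _%:R; lia.
  have hE3 : (h.*2.+2)%:R = 2 * h%:R + 2 :> rat by rewrite -(natrM _ 2) -natrD; congr _%:R; lia.
  have key : (h.+1)%:R * (h ^_ c./2)%:~R = (h.+1%:R - (c./2)%:R) * (h.+1 ^_ c./2)%:~R :> rat.
    have [ch|hc] := leqP c./2 h.+1; last by rewrite !ffact_small ?mulr0 // ltnW.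
    by rewrite -natrB // -!natrM -ffactSS ffactnSr mulnC.
  rewrite !(rmorphD, rmorphM, rmorphXn) /= cE hE hE2 hE3.
  move: key; rewrite -natr1 => key.
  transitivity (herm_unit h.*2 * (2 * h%:R + 1) * (-2) ^+ c./2 *
     (- (2 * (c./2)%:R + 1) * (h.+1 ^_ c./2)%:~R - 2 * ((h%:R + 1) * (h ^_ c./2)%:~R))).
    ring.
  rewrite key; ring.
Qed.

(** * Expansion of the Wronskian *)

(** Multilinearity in the columns: [f] selects one summand for each column, and [A j (f j)] factors
    out of column [j]. *)
Lemma det_sum_expand (R : comNzRingType) (r N : nat) (G A : 'I_r -> 'I_N -> R) :
  \det (\matrix_(i < r, j < r) \sum_(c < N) G i c * A j c) =
  \sum_(f : {ffun 'I_r -> 'I_N})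
     (\prod_j A j (f j)) * \det (\matrix_(i < r, j < r) G i (f j)).
Proof.
rewrite -det_tr {1}/determinant.
transitivity (\sum_(s : 'S_r) \sum_(f : {ffun 'I_r -> 'I_N})
    (-1) ^+ s * \prod_j (G (s j) (f j) * A j (f j))).
  apply: eq_bigr => s _; rewrite -big_distrr /=; congr (_ * _).
  rewrite -(bigA_distr_bigA (fun j c => G (s j) c * A j c)); apply: eq_bigr => j _; by rewrite !mxE.
rewrite exchange_big /=; apply: eq_bigr => f _.
rewrite -det_tr /determinant big_distrr /=; apply: eq_bigr => s _.
rewrite big_split /= [RHS]mulrCA; congr (_ * _); rewrite mulrC; congr (_ * _).
by apply: eq_bigr => j _; rewrite !mxE.
Qed.

Definition hermite_wronskian (r : nat) (n : 'I_r -> nat) : {poly rat} :=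
  \det (\matrix_(i < r, j < r) (He (n j))^`(i)).

(** The Wronskian of the monomials [X^(c j)] is this number times a power of [X]. *)
Definition ffact_det (r : nat) (c : 'I_r -> nat) : rat :=
  \det (\matrix_(i < r, j < r) ((c j) ^_ i)%:R).

Lemma Xn_derivn (i N : nat) (f : {poly rat}) : (size f <= N)%N ->
  'X^i * f^`(i) = \sum_(c < N) (c ^_ i)%:R%:P * (f`_c *: 'X^c).
Proof.
move=> sf; apply/polyP => k; rewrite coefXnM coef_sum.
rewrite (eq_bigr (fun c : 'I_N => if k == c then (c ^_ i)%:R * f`_c else 0)); last first.
  by move=> c _; rewrite coefCM coefZ coefXn; case: eqP; rewrite ?mulr1 ?mulr0.
rewrite -big_mkcond /=.
have [kN|Nk] := ltnP k N; last first.
  rewrite big_pred0 => [|c]; last by apply/negP => /eqP E; have := ltn_ord c; lia.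
  case: ifP => // ki; rewrite coef_derivn (_ : f`_(i + (k - i)) = 0) ?mul0rn //.
  by apply: nth_default; apply: leq_trans sf _; lia.
rewrite (big_pred1 (Ordinal kN)) => [|c]; last by rewrite eq_sym.
case: ltnP => [ki|ik] /=; first by rewrite ffact_small // mul0r.
by rewrite coef_derivn subnKC // mulr_natl.
Qed.

(** Multiplying row [i] by [X^i] makes the [i]-th derivative act on [X^c] as the scalar [c ^_ i], at
    the cost of a factor [X^'C(r, 2)] on the determinant. This shifts the exponents by
    ['C(r, 2)]. *)
Lemma coef_hermite_wronskian (r N : nat) (n : 'I_r -> nat) (E : nat) :
  (forall j, size (He (n j)) <= N)%N ->
  (hermite_wronskian r n)`_E =
  \sum_(f : {ffun 'I_r -> 'I_N} | (\sum_j f j == 'C(r, 2) + E)%N)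
    (\prod_j (He (n j))`_(f j)) * ffact_det r (fun j => f j).
Proof.
move=> nN.
have sumI : (\sum_(i < r) i = 'C(r, 2))%N.
  by rewrite -(big_mkord xpredT id) bin2_sum.
have EX : 'X^('C(r, 2)) * hermite_wronskian r n =
    \sum_(f : {ffun 'I_r -> 'I_N})
    ((\prod_j (He (n j))`_(f j)) * ffact_det r (fun j => f j)) *: 'X^(\sum_j f j).
  have -> : 'X^('C(r, 2)) = \det (diag_mx (\row_(i < r) 'X^i)) :> {poly rat}.
    rewrite det_diag -sumI -prodrXr; apply: eq_bigr => i _; by rewrite mxE.
  rewrite -det_mulmx.
  have -> : diag_mx (\row_(i < r) 'X^i) *m (\matrix_(i < r, j < r) (He (n j))^`(i)) =
     \matrix_(i < r, j < r) \sum_(c < N) (c ^_ i)%:R%:P * ((He (n j))`_c *: 'X^c).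
    apply/matrixP => i j; rewrite mul_diag_mx !mxE; exact: Xn_derivn.
  rewrite det_sum_expand; apply: eq_bigr => f _.
  have -> : \matrix_(i < r, j < r) ((f j) ^_ i)%:R%:P =
     map_mx polyC (\matrix_(i < r, j < r) ((f j) ^_ i)%:R) :> 'M[{poly rat}]_r.
    by apply/matrixP => i j; rewrite !mxE.
  rewrite det_map_mx /= -/(ffact_det _ _) scaler_prod prodrXr.
  by rewrite mulrC mul_polyC scalerA mulrC.
have -> : (hermite_wronskian r n)`_E = ('X^('C(r, 2)) * hermite_wronskian r n)`_('C(r, 2) + E).
  by rewrite coefXnM ltnNge leq_addr addKn.
rewrite EX coef_sum [RHS]big_mkcond; apply: eq_bigr => f _.
by rewrite coefZ coefXn eq_sym; case: eqP; rewrite ?mulr1 ?mulr0.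
Qed.

(** * Falling factorials, Vandermonde determinants and hook products *)

Definition ffact_poly (R : comNzRingType) (g : nat) : {poly R} :=
  \prod_(k < g) ('X - k%:R%:P).

Lemma size_ffact_poly (R : comNzRingType) (g : nat) : size (ffact_poly R g) = g.+1.
Proof. by rewrite size_prod_XsubC /index_enum -enumT size_enum_ord. Qed.

Lemma lead_coef_ffact_poly (R : comNzRingType) (g : nat) : (ffact_poly R g)`_g = 1.
Proof.
have /monicP := monic_prod_XsubC (index_enum 'I_g) xpredT (fun k : 'I_g => (k : nat)%:R : R).
by rewrite /lead_coef size_ffact_poly.
Qed.

Lemma horner_ffact_poly (R : comNzRingType) (g h : nat) :
  (ffact_poly R g).[h%:R] = (h ^_ g)%:R.
Proof.
elim: g => [|g IH]; first by rewrite /ffact_poly big_ord0 hornerC.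
rewrite /ffact_poly big_ord_recr /= hornerM IH hornerXsubC ffactnSr natrM.
have [hg|gh] := leqP g h; first by rewrite natrB.
by rewrite ffact_small // !mul0r.
Qed.

(** Falling factorials are monic polynomials of degree [i], so the matrix is a unitriangular [L]
    times a Vandermonde matrix. *)
Lemma ffact_det_Vandermonde (r : nat) (c : 'I_r -> nat) :
  ffact_det r c = \prod_(i < r) \prod_(j < r | (i < j)%N) ((c j)%:R - (c i)%:R).
Proof.
pose L := \matrix_(i < r, k < r) (ffact_poly rat i)`_k.
pose a : 'rV[rat]_r := \row_j (c j)%:R.
have -> : ffact_det r c = \det (L *m Vandermonde r a).
  congr (\det _); apply/matrixP => i j; rewrite !mxE -horner_ffact_poly.
  rewrite (@horner_coef_wide _ r) ?size_ffact_poly //.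
  by apply: eq_bigr => k _; rewrite !mxE.
rewrite det_mulmx det_Vandermonde det_trig; last first.
  by apply/is_trig_mxP => i k ik; rewrite mxE nth_default // size_ffact_poly.
rewrite big1 ?mul1r => [|i _]; last by rewrite mxE lead_coef_ffact_poly.
by apply: eq_bigr => i _; apply: eq_bigr => j _; rewrite !mxE.
Qed.

(** A product over unordered pairs does not depend on how each pair is oriented, as its square runs
    over all ordered pairs. It serves to replace the order of the indices by the order of the values
    [c i]. *)
Lemma prod_sym_sq (r : nat) (Rel : rel 'I_r) (F : 'I_r -> 'I_r -> nat) :
  (forall i j, F i j = F j i) ->
  (forall i j, Rel i j = (i != j) && ~~ Rel j i) ->
  (\prod_(i < r) \prod_(j < r | i != j) F i j =
   (\prod_(i < r) \prod_(j < r | Rel i j) F i j) ^ 2)%N.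
Proof.
move=> sF hR; rewrite -mulnn.
have -> : (\prod_(i < r) \prod_(j < r | i != j) F i j =
    \prod_(i < r) ((\prod_(j < r | Rel i j) F i j) * (\prod_(j < r | Rel j i) F i j)))%N.
  apply: eq_bigr => i _; rewrite (bigID (Rel i)) /=; congr (_ * _)%N; apply: eq_bigl => j.
    by rewrite [Rel i j]hR; case: (i != j) => //=; case: (Rel j i).
  by rewrite [Rel j i]hR eq_sym.
rewrite big_split /=; congr (_ * _)%N.
by rewrite (exchange_big_dep xpredT) //=; apply: eq_bigr => i _; apply: eq_bigr.
Qed.

Lemma big_codom (R : Type) (idx : R) (op : Monoid.com_law idx) (r : nat)
    (c : 'I_r -> nat) (P : pred nat) (F : nat -> R) :
  \big[op/idx]_(y <- codom c | P y) F y = \big[op/idx]_(j | P (c j)) F (c j).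
Proof. by rewrite big_map big_enum_cond. Qed.

(** Write [c!] as the product of [c - b] over all [b < c]. The beads [b] give the Vandermonde
    product, the gaps give the hook lengths; this is Frobenius' formula for the hook product. *)
Lemma ffact_det_hook_prod (r : nat) (c : 'I_r -> nat) : injective c ->
  `|ffact_det r c| * (hook_prod (codom c))%:R = (\prod_j (c j)`!)%:R.
Proof.
move=> ci; have us : uniq (codom c) by rewrite map_inj_uniq // enum_uniq.
pose F i j := ((c i - c j) + (c j - c i))%N.
have -> : `|ffact_det r c| = (\prod_(i < r) \prod_(j < r | (i < j)%N) F i j)%:R.
  rewrite ffact_det_Vandermonde normr_prod natr_prod; apply: eq_bigr => i _.
  rewrite normr_prod natr_prod; apply: eq_bigr => j _; rewrite /F.
  have [ij|ji] := leqP (c i) (c j).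
    by rewrite -natrB // normr_nat (eqP ij).
  by rewrite distrC -natrB ?(ltnW ji) // normr_nat (eqP (ltnW ji)) addn0.
rewrite -natrM; congr _%:R.
have -> : (\prod_(i < r) \prod_(j < r | (i < j)%N) F i j =
           \prod_(i < r) \prod_(j < r | (c j < c i)%N) F i j)%N.
  apply/eqP; rewrite -(eqn_exp2r _ _ (e := 2)) //; apply/eqP.
  rewrite -(@prod_sym_sq r (fun i j : 'I_r => (i < j)%N)).
  - rewrite -(@prod_sym_sq r (fun i j : 'I_r => (c j < c i)%N)) // => i j; rewrite /F; first lia.
    by rewrite -leqNgt ltn_neqAle (inj_eq ci) eq_sym.
  - by move=> i j; rewrite /F; lia.
  - by move=> i j; rewrite -leqNgt ltn_neqAle.
rewrite /hook_prod big_codom -big_split /=; apply: eq_bigr => i _.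
rewrite -ffactnn ffact_prod [RHS](bigID (fun b : 'I_(c i) => (b : nat) \in codom c)) /=.
congr (_ * _)%N.
rewrite (big_ord_mem _ _ _ _ _ (fun b => c i - b)%N us) big_codom.
by apply: eq_bigr => j ji; rewrite /F; lia.
Qed.

Lemma ffact_det_eq0 (r : nat) (c : 'I_r -> nat) : ffact_det r c != 0 -> injective c.
Proof.
move=> c0 i j cij; have [//|ij] := eqVneq i j.
suff : ffact_det r c = 0 by move/eqP; rewrite (negPf c0).
wlog lij : i j cij ij / (i < j)%N => [h|].
  have [lij|lji|/val_inj E] := ltngtP i j; last by rewrite E eqxx in ij.
    exact: h cij ij lij.
  by apply: (h j i) => //; rewrite eq_sym.
rewrite ffact_det_Vandermonde (bigD1 i) //= (bigD1 j) //= cij subrr !mul0r //.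
Qed.

(** * The lowest coefficient *)

Lemma herm_int_neq0 (n c : nat) : herm_int n c != 0 -> odd c = odd n /\ (c <= n)%N.
Proof.
rewrite /herm_int; case: (odd n =P odd c) => [E|_]; last by rewrite eqxx.
rewrite mulf_eq0 negb_or => /andP[_ h]; split=> //.
have : (c./2 <= n./2)%N.
  by rewrite leqNgt; apply: contraNN h => h; rewrite ffact_small.
rewrite -(odd_double_half n) -[in X in _ -> X](odd_double_half c) E; lia.
Qed.

Lemma coef_He_neq0 (n c : nat) : (He n)`_c != 0 -> odd c = odd n /\ (c <= n)%N.
Proof.
move=> h; apply: herm_int_neq0; apply: contraNneq h => h.
by rewrite coef_He h mulr0 mul0r.
Qed.

Lemma size_He (n : nat) : (size (He n) <= n.+1)%N.
Proof.
apply/leq_sizeP => c nc; apply: contraTeq nc => /coef_He_neq0[_ h]; lia.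
Qed.

Lemma count_odd_codom (r : nat) (f n : 'I_r -> nat) : (forall j, odd (f j) = odd (n j)) ->
  count odd (codom f) = count odd (codom n).
Proof.
move=> h; rewrite -!sum1_count !big_codom; apply: eq_bigl => j; exact: h.
Qed.

Lemma core_sum_codom (r : nat) (f n : 'I_r -> nat) : (forall j, odd (f j) = odd (n j)) ->
  core_sum (codom f) = core_sum (codom n).
Proof.
move=> h; have E := count_odd_codom r f n h; rewrite /core_sum E.
have := count_predC odd (codom f); have := count_predC odd (codom n).
rewrite !size_codom E => <- /eqP; rewrite eqn_add2l => /eqP -> //.
Qed.

(** * Beta-sets of 2-cores and the terms of the lowest coefficient *)

Definition core_beta (e o : nat) : seq nat :=
  [seq i.*2 | i <- iota 0 e] ++ [seq i.*2.+1 | i <- iota 0 o].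

Lemma mem_core_beta (e o c : nat) :
  (c \in core_beta e o) = (c./2 < if odd c then o else e)%N.
Proof.
rewrite mem_cat; apply/idP/idP.
  case/orP => /mapP[i]; rewrite mem_iota /= => hi ->.
    by rewrite odd_double doubleK.
  by rewrite /= odd_double /= uphalf_double.
move=> h; apply/orP; have := odd_double_half c; case: ifP h => oc h E; [right|left];
  apply/mapP; exists c./2; rewrite ?mem_iota //; lia.
Qed.

Lemma core_beta_uniq (e o : nat) : uniq (core_beta e o).
Proof.
rewrite cat_uniq !map_inj_uniq ?iota_uniq /= ?andbT; [|by move=> x y; lia..].
by apply/hasPn => x /mapP[i _ ->]; apply/negP => /mapP[j _]; lia.
Qed.

Lemma size_core_beta (e o : nat) : size (core_beta e o) = (e + o)%N.
Proof. by rewrite size_cat !size_map !size_iota. Qed.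

Lemma sum_core_beta (e o : nat) :
  (\sum_(x <- core_beta e o) x = e * e.-1 + o ^ 2)%N.
Proof.
rewrite big_cat !big_map /=; congr (_ + _)%N.
  elim: e => [|e IH]; first by rewrite big_nil.
  by rewrite -addn1 iotaD big_cat big_seq1 /= IH; case: (e) => //= e'; lia.
elim: o => [|o IH]; first by rewrite big_nil.
by rewrite -addn1 iotaD big_cat big_seq1 /= IH -!mulnn; lia.
Qed.

(** Without even hooks, all smaller numbers of the parity of [c] are beads too. With [c] they form
    the list [t] of [(c./2).+1] beads of one parity. *)
Lemma hook_count2_eq0 (s : seq nat) (c : nat) : uniq s -> hook_count 2 s = 0%N -> c \in s ->
  c \in core_beta (count (predC odd) s) (count odd s).
Proof.
move=> us h0 cs.
have closed b : (b < c)%N -> odd b = odd c -> b \in s.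
  move=> bc ob; apply/negPn/negP => bs; move: h0.
  rewrite /hook_count (bigD1_seq c) //= (bigD1 (Ordinal bc)) //= bs /=.
  by rewrite -eqn_mod_dvd 1?ltnW // !modn2 ob eqxx; lia.
rewrite mem_core_beta.
pose t := [seq (i.*2 + odd c)%N | i <- iota 0 (c./2).+1].
have ot i : odd (i.*2 + odd c) = odd c by rewrite oddD odd_double oddb.
have ut : uniq t by rewrite map_inj_uniq ?iota_uniq // => x y; lia.
have st : {subset t <= s}.
  move=> x /mapP[i]; rewrite mem_iota /= => hi ->.
  have := odd_double_half c => E.
  have [->|ic] := eqVneq i c./2; first by rewrite addnC E.
  by apply: closed; rewrite ?ot //; lia.
have tp (P : pred nat) : {in t, forall x, P x} -> (c./2 < count P s)%N.
  move=> tP; rewrite -size_filter -[(c./2).+1](size_iota 0) -(size_map (fun i => (i.*2 + odd c)%N)).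
  by apply: uniq_leq_size => // x xt; rewrite mem_filter st // tP.
by case: ifP => oc; apply: tp => x /mapP[i _ ->]; rewrite /= ot oc.
Qed.

Lemma sum_codom (r : nat) (f : 'I_r -> nat) : (\sum_(x <- codom f) x = \sum_j f j)%N.
Proof. by rewrite (big_codom _ _ addn _ _ xpredT id). Qed.

Section LowestCoefficient.

Variables (r : nat) (n : 'I_r -> nat).

Let e := count (predC odd) (codom n).
Let o := count odd (codom n).
Let K := core_beta e o.

Lemma size_core_codom : size K = r.
Proof. by rewrite size_core_beta addnC count_predC size_codom card_ord. Qed.

Definition core_nth (l : 'I_r) : nat :=
  nth 0%N (core_beta (count (predC odd) (codom n)) (count odd (codom n))) l.

Definition herm_int_core : 'M[int]_r := \matrix_(l < r, j < r) herm_int (n j) (core_nth l).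

Lemma codom_core_nth : codom core_nth = K.
Proof.
rewrite /codom /image_mem -[RHS](mkseq_nth 0%N) size_core_codom /mkseq.
by rewrite -val_enum_ord -map_comp.
Qed.

Lemma core_nth_inj : injective core_nth.
Proof.
move=> i j /eqP; rewrite nth_uniq ?core_beta_uniq -/K ?size_core_codom //.
by move/eqP/val_inj.
Qed.

(** In a nonzero term [f] is injective with the parities of [n], so by [sum_hook2] its sum exceeds
    [core_sum] by twice its number of even hooks. The minimum is reached exactly on the enumerations
    of [K]. *)
Lemma ffact_core_term (f : 'I_r -> nat) :
  \prod_j (He (n j))`_(f j) * ffact_det r f != 0 ->
  (\sum_j f j == core_sum (codom n))%N = [forall j, f j \in K].
Proof.
rewrite mulf_eq0 negb_or => /andP[hA hV].
have fi := ffact_det_eq0 _ _ hV.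
have us : uniq (codom f) by rewrite map_inj_uniq // enum_uniq.
have par j : odd (f j) = odd (n j).
  by have := hA; rewrite prodf_seq_neq0 => /allP/(_ j (mem_index_enum _))/coef_He_neq0[].
have Eo := count_odd_codom r f n par.
have Ee : count (predC odd) (codom f) = e.
  have := count_predC odd (codom f); have := count_predC odd (codom n).
  by rewrite !size_codom Eo -/e -/o; lia.
have Es := sum_hook2 _ us; rewrite -/(core_sum _) sum_codom -addnA in Es.
have {Es} Es : (\sum_j f j = 2 * hook_count 2 (codom f) + core_sum (codom n))%N.
  by rewrite Es -(core_sum_codom r f n par).
apply/idP/forallP => [/eqP E j|fK].
  rewrite /K /e /o -Eo -/e -Ee; apply: hook_count2_eq0 => //; first by lia.
  exact: codom_f.
rewrite -sum_codom (perm_big K) /=.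
  by rewrite sum_core_beta /core_sum -/e -/o.
apply: uniq_perm => //; first exact: core_beta_uniq.
have sub : {subset codom f <= K} by move=> x /codomP[j ->].
have le : (size K <= size (codom f))%N by rewrite size_core_codom size_codom card_ord.
by have [_] := uniq_min_size us sub le.
Qed.

(** The sum restricted to values in [K] folds back into one determinant, whose matrix is a product
    of four: falling factorials of [K], inverse factorials, [herm_int_core], and the diagonal of the
    units. *)
Lemma hermite_wronskian_low (E : nat) : (core_sum (codom n) = 'C(r, 2) + E)%N ->
  (hermite_wronskian r n)`_E =
  (\prod_j herm_unit (n j)) * (ffact_det r core_nth / (\prod_l (core_nth l)`!)%:R) *
  (\det herm_int_core)%:~R.
Proof.
(* [N] must exceed both the degrees [n j] and the elements of [K], which are smaller than [2 r]. *)
move=> hE; pose N := (\sum_j n j + r.*2).+1.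
have nN j : (size (He (n j)) <= N)%N.
  apply: leq_trans (size_He _) _; rewrite ltnS (bigD1 j) //=; lia.
have kN l : (core_nth l < N)%N.
  have : core_nth l \in K by rewrite mem_nth // -/K size_core_codom.
  rewrite mem_core_beta => h.
  have eo : (e + o = r)%N by rewrite -size_core_beta size_core_codom.
  have := odd_double_half (core_nth l); rewrite /N; case: ifP h => _ h; lia.
rewrite (coef_hermite_wronskian r N) // -hE big_mkcond.
(* Truncating the coefficients to [K] moves the condition on [f] into the factors; the sum becomes
   unrestricted and [det_sum_expand] applies backwards. *)
pose A' (j : 'I_r) (c : 'I_N) := if (c : nat) \in K then (He (n j))`_c else 0.
transitivity (\sum_(f : {ffun 'I_r -> 'I_N})
    (\prod_j A' j (f j)) * \det (\matrix_(i < r, j < r) ((f j) ^_ i)%:R)).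
  apply: eq_bigr => f _; rewrite -/(ffact_det r (fun j => f j)).
  have [t0|t0] := eqVneq (\prod_j (He (n j))`_(f j) * ffact_det r (fun j => f j)) 0.
    rewrite t0 if_same; move/eqP: t0; rewrite mulf_eq0 => /orP[|/eqP->]; last by rewrite mulr0.
    move=> /prodf_eq0[j _ /eqP hj]; rewrite (bigD1 j) //= /A' hj if_same !mul0r //.
  rewrite ffact_core_term //; case: forallP => fK.
    by congr (_ * _); apply: eq_bigr => j _; rewrite /A' fK.
  have /forallPn[j hj] : ~~ [forall j, (f j : nat) \in K] by apply/forallP.
  by rewrite (bigD1 j) //= /A' (negPf hj) !mul0r.
rewrite -(det_sum_expand _ _ _ (fun i c => ((c : nat) ^_ i)%:R)).
have -> : \matrix_(i < r, j < r) (\sum_(c < N) (c ^_ i)%:R * A' j c) =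
    (\matrix_(i < r, l < r) (core_nth l ^_ i)%:R) *m
    (diag_mx (\row_l (core_nth l)`!%:R^-1) *m map_mx intr herm_int_core *m
     diag_mx (\row_j herm_unit (n j))) :> 'M[rat]_r.
  apply/matrixP => i j; rewrite !mxE.
  transitivity (\sum_(c < N | (c : nat) \in codom core_nth) (c ^_ i)%:R * (He (n j))`_c).
    rewrite codom_core_nth [RHS]big_mkcond; apply: eq_bigr => c _; rewrite /A'.
    by case: ifP; rewrite ?mulr0.
  rewrite (big_ord_mem _ _ _ _ _ (fun c => (c ^_ i)%:R * (He (n j))`_c)); last first.
    by rewrite codom_core_nth core_beta_uniq.
  rewrite big_codom; apply: eq_big => [l|l _]; first exact: kN.
  by rewrite mul_mx_diag mul_diag_mx !mxE coef_He; ring.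
rewrite !det_mulmx !det_diag -/(ffact_det r core_nth) det_map_mx /=.
rewrite (eq_bigr (fun l => (core_nth l)`!%:R^-1)) => [|l _]; last by rewrite mxE.
rewrite [X in _ * (_ * X)](eq_bigr (fun l => herm_unit (n l))) => [|l _]; last by rewrite mxE.
by rewrite prodfV natr_prod; ring.
Qed.

End LowestCoefficient.

(** * Nonvanishing modulo [p] of the determinant in the lowest coefficient *)

(** Monic polynomials of distinct degrees are linearly independent: look at the highest degree with
    nonzero weight. *)
Lemma ffact_poly_free (R : comNzRingType) (r : nat) (P : pred 'I_r) (g : 'I_r -> nat)
    (w : 'I_r -> R) :
  {in P &, injective g} -> \sum_(l | P l) w l *: ffact_poly R (g l) = 0 ->
  forall l, P l -> w l = 0.
Proof.
move=> gi S0 l0 Pl0; apply/eqP/negPn/negP => w0.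
have h0 : P l0 && (w l0 != 0) by rewrite Pl0.
case: (arg_maxnP (P := fun l => P l && (w l != 0)) g h0) => l /andP[Pl wl] lmax.
move/(congr1 (fun q : {poly R} => q`_(g l))): S0; rewrite coef0 coef_sum (bigD1 l) //=.
rewrite coefZ lead_coef_ffact_poly mulr1 big1 ?addr0; first by move/eqP; rewrite (negPf wl).
move=> i /andP[Pi il]; rewrite coefZ.
have [->|wi] := eqVneq (w i) 0; first by rewrite mul0r.
have gil : (g i <= g l)%N by apply: lmax; rewrite Pi.
rewrite nth_default ?mulr0 // size_ffact_poly ltn_neqAle gil andbT.
by apply: contraNneq il => /gi ->.
Qed.

Lemma natr_Fp_inj (p a b : nat) : prime p -> a%:R = b%:R :> 'F_p -> a = b %[mod p].
Proof.
move=> pp; wlog ab : a b / (a <= b)%N => [h E|E].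
  by have [ab|ba] := leqP a b; [exact: h|apply/esym/h => //; exact: ltnW].
apply/eqP; rewrite eq_sym eqn_mod_dvd // (dvdn_pcharf (pchar_Fp pp)) natrB //.
by rewrite E subrr.
Qed.

(* A kernel vector yields, for each parity class, a polynomial over F_p with as
   many distinct roots as its size, hence zero. *)
Lemma herm_int_core_det (p r : nat) (n : 'I_r -> nat) : prime p -> odd p ->
  (forall i j, n i = n j %[mod p] -> i = j) ->
  ~~ (p %| `|\det (herm_int_core r n)|)%N.
Proof.
move=> pp op nmod.
have := dvdz_pcharf (pchar_Fp pp) (\det (herm_int_core r n)).
rewrite dvdzE /= => ->; rewrite -det_map_mx; apply/det0P => -[v v0 vA].
case/negP: v0; apply/eqP/rowP => l0; rewrite mxE.
set k := core_nth r n.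
pose cnt b := if b then count odd (codom n) else count (predC odd) (codom n).
have ksmall l : ((k l)./2 < cnt (odd (k l)))%N.
  have : k l \in codom k by apply: codom_f.
  by rewrite codom_core_nth mem_core_beta /cnt; case: odd.
(* [w] absorbs the powers of [-2] in [herm_int]; they are invertible in [F_p] by [two0]. *)
pose w l := v 0 l * (-2) ^+ (k l)./2.
have two0 : (-2) != 0 :> 'F_p.
  rewrite oppr_eq0 -(dvdn_pcharf (pchar_Fp pp)); apply/negP => /dvdn_leq.
  by move=> /(_ isT); case: p pp op {nmod vA v w l0 k cnt ksmall} => [|[|[|]]].
pose b := odd (k l0).
(* The kernel equation for column [j] says that [(n j)./2] is a root of [Q] whenever [n j] has
   parity [b]. These roots are distinct mod [p] and as many as the elements of [K] of that parity,
   which bounds the size of [Q]. *)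
pose Q := \sum_(l | odd (k l) == b) w l *: ffact_poly 'F_p (k l)./2.
have Q0 : Q = 0.
  pose rs := [seq (n j)./2%:R : 'F_p | j <- enum 'I_r & odd (n j) == b].
  apply: (@roots_geq_poly_eq0 _ Q rs).
  - apply/allP => x /mapP[j]; rewrite mem_filter => /andP[/eqP nj _] ->.
    have := congr1 (fun M : 'rV_r => M 0 j) vA; rewrite !mxE => vAj.
    rewrite /root /Q horner_sum -[X in _ == X]vAj [X in _ == X](bigID (fun l => odd (k l) == b)) /=.
    rewrite [X in _ == _ + X]big1 ?addr0 => [|l kl]; last first.
      by rewrite !mxE /herm_int -/k nj eq_sym (negPf kl) mulr0.
    apply/eqP; apply: eq_bigr => l kl.
    rewrite hornerZ horner_ffact_poly !mxE /herm_int -/k nj eq_sym kl.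
    by rewrite rmorphM rmorphXn /= /w mulrA.
  - rewrite map_inj_in_uniq ?filter_uniq -?enumT ?enum_uniq // => i j.
    rewrite !mem_filter => /andP[/eqP ni _] /andP[/eqP nj _] /(natr_Fp_inj _ _ _ pp) E.
    apply: nmod; rewrite -(odd_double_half (n i)) -(odd_double_half (n j)) ni nj -!muln2.
    by apply/eqP; rewrite eqn_modDl -modnMml E modnMml.
  - apply/leq_sizeP => i hi; rewrite coef_sum big1 // => l /eqP kl.
    rewrite coefZ nth_default ?mulr0 // size_ffact_poly.
    apply: leq_trans (ksmall l) _; rewrite kl; apply: leq_trans hi.
    rewrite size_map size_filter /cnt /codom !count_map.
    by case: (b); rewrite leq_eqVlt; apply/orP; left; apply/eqP/eq_count => j /=; case: odd.
have : w l0 = 0.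
  apply: (ffact_poly_free _ r (fun l => odd (k l) == b) (fun l => (k l)./2) w) => //.
  move=> i j /eqP ki /eqP kj hk; apply: (core_nth_inj r n); rewrite -/k.
  by rewrite -(odd_double_half (k i)) -(odd_double_half (k j)) ki kj hk.
by move/eqP; rewrite mulf_eq0 expf_eq0 (negPf two0) andbF orbF => /eqP.
Qed.

Lemma ffact_ratio (r : nat) (c : 'I_r -> nat) : injective c ->
  `|ffact_det r c / (\prod_j (c j)`!)%:R| = (hook_prod (codom c))%:R^-1.
Proof.
move=> ci; have H := ffact_det_hook_prod r c ci.
have f0 : (\prod_j (c j)`!)%:R != 0 :> rat.
  by rewrite pnatr_eq0 -lt0n prodn_cond_gt0 // => j _; rewrite fact_gt0.
have h0 : (hook_prod (codom c))%:R != 0 :> rat by rewrite pnatr_eq0 -lt0n hook_prod_gt0.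
rewrite normrM normfV normr_nat -H invfM mulrA divff ?mul1r //.
by apply: contraNneq f0; rewrite -H => ->; rewrite mul0r.
Qed.

Lemma nu_norm (p : nat) (x : rat) : nu p `|x| = nu p x.
Proof. by have [h|h] := leP 0 x; [rewrite ger0_norm | rewrite ltr0_norm ?nuN]. Qed.

Lemma hermite_wronskian_low_nu (p r E : nat) (n : 'I_r -> nat) : prime p -> odd p ->
  (forall i j, n i = n j %[mod p] -> i = j) ->
  (core_sum (codom n) = 'C(r, 2) + E)%N ->
  (hermite_wronskian r n)`_E != 0 /\
  nu p (hermite_wronskian r n)`_E =
    nu p (\prod_j herm_unit (n j)) - (logn p (hook_prod (codom (core_nth r n))))%:Z.
Proof.
move=> pp op nmod hE; rewrite (hermite_wronskian_low r n E hE).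
have := herm_int_core_det p r n pp op nmod; set d := \det _ => pd.
have d0 : d != 0 by apply: contraNneq pd => ->; rewrite dvdn0.
have R := ffact_ratio r _ (core_nth_inj r n).
move: R; set R := ffact_det _ _ / _ => HR.
clearbody d R.
have h0 : (hook_prod (codom (core_nth r n)))%:R != 0 :> rat.
  by rewrite pnatr_eq0 -lt0n hook_prod_gt0.
have R0 : R != 0 by rewrite -normr_eq0 HR invr_eq0.
have U0 : \prod_j herm_unit (n j) != 0 by apply/prodf_neq0 => j _; apply: herm_unit_neq0.
have dr0 : d%:~R != 0 :> rat by rewrite intr_eq0.
split; first by rewrite !mulf_neq0.
rewrite (nuM p _ _ (mulf_neq0 U0 R0) dr0) (nuM p _ _ U0 R0)
  -[nu p R]nu_norm HR nuV // nu_nat ?hook_prod_gt0 // nu_int //.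
by rewrite [logn p `|d|%N]lognE (negPf pd) !andbF addr0.
Qed.

(** * Valuations and support of the other coefficients *)

(** Divided by the units and multiplied by [p ^ V], the coefficient is a sum of integers times
    [p ^ V / H(f)] up to sign, all of them [p]-integral. *)
Lemma hermite_wronskian_nu_ge (p r E V : nat) (n : 'I_r -> nat) : prime p ->
  (forall f : 'I_r -> nat, injective f -> (forall j, odd (f j) = odd (n j)) ->
     (forall j, (f j <= n j)%N) ->
     (\sum_j f j = 'C(r, 2) + E)%N -> (logn p (hook_prod (codom f)) <= V)%N) ->
  (hermite_wronskian r n)`_E != 0 ->
  nu p (\prod_j herm_unit (n j)) - V%:Z <= nu p (hermite_wronskian r n)`_E.
Proof.
move=> pp hV W0; pose N := (\sum_j n j).+1.
have nN j : (size (He (n j)) <= N)%N.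
  apply: leq_trans (size_He _) _; rewrite ltnS (bigD1 j) //=; lia.
have U0 : \prod_j herm_unit (n j) != 0 by apply/prodf_neq0 => j _; apply: herm_unit_neq0.
have p0 : (0 < p ^ V)%N by rewrite expn_gt0 prime_gt0.
have pV0 : (p ^ V)%:R != 0 :> rat by rewrite pnatr_eq0 -lt0n.
pose x := (p ^ V)%:R * ((hermite_wronskian r n)`_E / \prod_j herm_unit (n j)).
have x0 : x != 0 by rewrite !mulf_neq0 ?invr_eq0.
suff px : pint p x.
  have := pint_nu p x pp x0 px.
  rewrite /x !nuM ?mulf_neq0 ?invr_eq0 // nuV // nu_nat // pfactorK //; lia.
have -> : x = \sum_(f : {ffun 'I_r -> 'I_N} | (\sum_j f j == 'C(r, 2) + E)%N)
   ((\prod_j herm_int (n j) (f j))%:~R *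
    ((p ^ V)%:R * (ffact_det r (fun j => f j) / (\prod_j (f j)`!)%:R))).
  rewrite /x (coef_hermite_wronskian r N) // mulr_suml mulr_sumr; apply: eq_bigr => f _.
  rewrite (eq_bigr (fun j => herm_unit (n j) *
      ((herm_int (n j) (f j))%:~R * (f j)`!%:R^-1))); last first.
    by move=> j _; rewrite coef_He mulrA.
  have -> : \prod_j (herm_unit (n j) * ((herm_int (n j) (f j))%:~R * (f j)`!%:R^-1)) =
      (\prod_j herm_unit (n j)) *
      ((\prod_j herm_int (n j) (f j))%:~R * (\prod_j (f j)`!)%:R^-1).
    rewrite big_split /=; congr (_ * _).
    by rewrite big_split /= prodfV rmorph_prod natr_prod.
  move: (\prod_j herm_unit _) U0 => U U0.
  have F0 : (\prod_j (f j)`!)%:R != 0 :> rat.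
    by rewrite pnatr_eq0 -lt0n prodn_cond_gt0 // => j _; rewrite fact_gt0.
  move: ((\prod_j (f j)`!)%:R) F0 => F F0; by field; rewrite U0 F0.
apply: pint_sum => // f /eqP Ef.
have [B0|B0] := eqVneq (\prod_j herm_int (n j) (f j)) 0.
  by rewrite B0 mul0r; apply: (pint_intr p 0).
have [V0|V0] := eqVneq (ffact_det r (fun j => f j)) 0.
  by rewrite V0 mul0r !mulr0; apply: (pint_intr p 0).
have fi := ffact_det_eq0 _ _ V0.
have par j : odd (f j) = odd (n j) /\ (f j <= n j)%N.
  by have := B0; rewrite prodf_seq_neq0 => /allP/(_ j (mem_index_enum _))/herm_int_neq0.
have hL := hV _ fi (fun j => (par j).1) (fun j => (par j).2) Ef.
apply: pintM => //; first exact: pint_intr.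
have HR := ffact_ratio r _ fi; move: HR; set R := ffact_det _ _ / _ => HR.
have ph : pint p ((p ^ V)%:R * `|R|).
  rewrite HR; apply: pint_div => //; first exact: hook_prod_gt0.
  by rewrite pfactorK.
have [R0|R0] := lerP 0 R; first by rewrite ger0_norm in ph.
rewrite ltr0_norm // in ph.
have -> : (p ^ V)%:R * R = (-1)%:~R * ((p ^ V)%:R * - R) by rewrite mulrN rmorphN mulN1r opprK.
by apply: pintM => //; apply: pint_intr.
Qed.

(** By [sum_hook2] no contributing [f] has a sum below that of the 2-core. *)
Lemma hermite_wronskian_below (r E : nat) (n : 'I_r -> nat) :
  ('C(r, 2) + E < core_sum (codom n))%N -> (hermite_wronskian r n)`_E = 0.
Proof.
move=> hE; pose N := (\sum_j n j).+1.
have nN j : (size (He (n j)) <= N)%N.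
  apply: leq_trans (size_He _) _; rewrite ltnS (bigD1 j) //=; lia.
rewrite (coef_hermite_wronskian r N) // big1 // => f /eqP Ef; apply/eqP/negPn/negP.
rewrite mulf_eq0 negb_or => /andP[hA hV].
have par j : odd (f j) = odd (n j).
  by have := hA; rewrite prodf_seq_neq0 => /allP/(_ j (mem_index_enum _))/coef_He_neq0[].
have us : uniq (codom (fun j => f j : nat)).
  by rewrite map_inj_uniq ?enum_uniq //; apply: ffact_det_eq0 hV.
have := sum_hook2 _ us; rewrite -/(core_sum _) sum_codom Ef.
rewrite -addnA -/(core_sum _) (core_sum_codom r _ n par); lia.
Qed.

Lemma hermite_wronskian_above (r E : nat) (n : 'I_r -> nat) :
  (\sum_j n j < 'C(r, 2) + E)%N -> (hermite_wronskian r n)`_E = 0.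
Proof.
move=> hE; pose N := (\sum_j n j).+1.
have nN j : (size (He (n j)) <= N)%N.
  apply: leq_trans (size_He _) _; rewrite ltnS (bigD1 j) //=; lia.
rewrite (coef_hermite_wronskian r N) // big1 // => f /eqP Ef; apply/eqP/negPn/negP.
rewrite mulf_eq0 negb_or => /andP[hA hV].
have le j : (f j <= n j)%N.
  by have := hA; rewrite prodf_seq_neq0 => /allP/(_ j (mem_index_enum _))/coef_He_neq0[].
have : (\sum_j f j <= \sum_j n j)%N by apply: leq_sum.
by rewrite Ef leqNgt hE.
Qed.

(** * Degree sequences, 2-cores and slopes *)

Lemma core_sum_slide2 (a : nat) (s : seq nat) : (2 <= a)%N ->
  core_sum (slide 2 a s) = core_sum s.
Proof.
move=> a2; have E x : odd (if x == a then a - 2 else x)%N = odd x.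
  by case: eqP => [->|] //; rewrite oddB // addbF.
have E1 : count odd (slide 2 a s) = count odd s.
  by rewrite count_map; apply: eq_count.
have E2 : count (predC odd) (slide 2 a s) = count (predC odd) s.
  by rewrite count_map; apply: eq_count => x /=; rewrite E.
by rewrite /core_sum E1 E2.
Qed.

(** Removing a 2-hook preserves parities, hence [core_sum]; in a terminal set no even hook is left
    and [sum_hook2] makes [core_sum] the actual sum. *)
Lemma reaches2core_dsize (s t : seq nat) : reaches2core s t -> uniq s ->
  core_sum s = ('C(size s, 2) + dsize t)%N.
Proof.
elim=> {s t} [s cl us|s a t as_ a2 n _ IH us].
  have h0 : hook_count 2 s = 0%N.
    apply/eqP; rewrite -leqn0 leqNgt; apply/negP => /(hook_count_gt0 2 s isT)[a as_ [a2]].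
    by rewrite cl.
  (* The bound at [P = 1] shows that the truncated subtraction in [dsize] is exact. *)
  have := sum_hook2 s us; have := hook_count_le 1 s isT us.
  by rewrite h0 /dsize /core_sum sumnE; lia.
rewrite -(core_sum_slide2 a s a2) IH ?size_map //; exact: slide_uniq.
Qed.

Lemma reaches2core_exists (s : seq nat) : uniq s -> exists t, reaches2core s t.
Proof.
move Eh: (hook_count 2 s) => h; elim: h s Eh => [|h IH] s Eh us.
  exists s; apply: core_stop => a as_ a2; apply/negPn/negP => n.
  by have := hook_count_slide 2 a s isT us as_ a2 n; rewrite Eh.
have [|a as_ [a2 n]] := hook_count_gt0 2 s isT; first by rewrite Eh.
have := hook_count_slide 2 a s isT us as_ a2 n; rewrite Eh => -[Eh'].
have [t ht] := IH _ (esym Eh') (slide_uniq _ _ _ us n).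
by exists t; apply: core_step ht.
Qed.

Lemma size_degseq (lam : seq nat) : size (degseq lam) = size lam.
Proof. by rewrite size_map size_iota. Qed.

Lemma nth_degseq (lam : seq nat) (i : nat) : (i < size lam)%N ->
  nth 0%N (degseq lam) i = (nth 0%N lam (size lam - 1 - i) + i)%N.
Proof. by move=> h; rewrite (nth_map 0%N) ?size_iota // nth_iota. Qed.

Lemma degseq_ltn (lam : seq nat) (i j : nat) : is_partition lam ->
  (i < j)%N -> (j < size lam)%N -> (nth 0%N (degseq lam) i < nth 0%N (degseq lam) j)%N.
Proof.
move=> par ij jl; rewrite !nth_degseq //; last exact: ltn_trans jl.
have : (nth 0%N lam (size lam - 1 - i) <= nth 0%N lam (size lam - 1 - j))%N.
  have geq_tr : transitive geq by move=> x y z h1 h2; apply: leq_trans h2 h1.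
  apply: (sorted_leq_nth geq_tr _ 0%N par); rewrite ?inE /=; try lia.
  by move=> x; apply: leqnn.
lia.
Qed.

Lemma degseq_uniq (lam : seq nat) : is_partition lam -> uniq (degseq lam).
Proof.
move=> par; apply/(uniqP 0%N) => i j; rewrite !inE size_degseq => il jl E.
case: (ltngtP i j) => // h.
  by have := degseq_ltn _ _ _ par h jl; rewrite E ltnn.
by have := degseq_ltn _ _ _ par h il; rewrite E ltnn.
Qed.

Lemma sum_degseq (lam : seq nat) :
  (\sum_(x <- degseq lam) x = sumn lam + 'C(size lam, 2))%N.
Proof.
rewrite big_map.
have -> : iota 0 (size lam) = index_iota 0 (size lam) by rewrite /index_iota subn0.
rewrite big_split /= bin2_sum; congr (_ + _)%N.
rewrite sumnE [RHS](big_nth 0%N) !big_mkord.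
rewrite [RHS](reindex_inj rev_ord_inj) /=; apply: eq_bigr => i _.
by congr (nth _ _ _); rewrite /=; lia.
Qed.

Lemma codom_nth (s : seq nat) : codom (fun j : 'I_(size s) => nth 0%N s j) = s.
Proof.
by rewrite /codom /image_mem -[RHS](mkseq_nth 0%N) /mkseq -val_enum_ord -map_comp.
Qed.

Lemma Wronskian_He (s : seq nat) :
  Wronskian [seq He k | k <- s] = hermite_wronskian (size s) (fun j => nth 0%N s j).
Proof.
rewrite /Wronskian; have := size_map He s; move: (size [seq He k | k <- s]) => r ->.
by congr (\det _); apply/matrixP => i j; rewrite !mxE (nth_map 0%N).
Qed.

Lemma coef_HeW (lam : seq nat) (E : nat) : (HeW lam)`_E =
  (Delta lam)%:R^-1 *
  (hermite_wronskian (size (degseq lam)) (fun j => nth 0%N (degseq lam) j))`_E.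
Proof. by rewrite /HeW coefZ Wronskian_He. Qed.

Lemma xvalE (q : {poly rat}) (E : nat) : q`_E != 0 -> (forall i, (i < E)%N -> q`_i = 0) ->
  xval q = E.
Proof.
move=> qE low; rewrite /xval.
have Es : (E < size q)%N by rewrite ltnNge; apply: contraNN qE => /(nth_default 0) ->.
have hs : has (fun c => c != 0) q by apply/hasP; exists q`_E => //; apply: mem_nth.
case: (ltngtP (find (fun c => c != 0) q) E) => // h.
  by have := nth_find 0 hs; rewrite low // eqxx.
by have := before_find 0 h; rewrite qE.
Qed.

Lemma Vdm_ndvd (p : nat) (s : seq nat) (i j : nat) : prime p -> ~~ (p %| Vdm s)%N ->
  (i < j)%N -> (j < size s)%N -> ~~ (p %| nth 0 s j - nth 0 s i)%N.
Proof.
move=> pp pV ij js; apply: contraNN pV => h; rewrite /Vdm.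
by rewrite (bigD1 (Ordinal js)) //= (bigD1 (Ordinal ij)) //= !dvdn_mulr.
Qed.

Lemma Euclid_ndvd_prod (p : nat) (I : finType) (F : I -> nat) : prime p ->
  (forall i, ~~ (p %| F i)%N) -> ~~ (p %| \prod_i F i)%N.
Proof.
move=> pp h; elim/big_rec: _ => [|i x _ hx]; first by rewrite gtnNdvd // prime_gt1.
by rewrite Euclid_dvdM // negb_or h.
Qed.

Lemma Delta_nmod (p : nat) (lam : seq nat) : is_partition lam -> prime p ->
  ~~ (p %| Delta lam)%N ->
  forall i j : 'I_(size (degseq lam)),
    nth 0%N (degseq lam) i = nth 0%N (degseq lam) j %[mod p] -> i = j.
Proof.
move=> par pp pD.
have key (i j : 'I_(size (degseq lam))) : (i < j)%N ->
    nth 0%N (degseq lam) i = nth 0%N (degseq lam) j %[mod p] -> False.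
  move=> ij /esym/eqP; have := ltn_ord j; rewrite [X in (_ < X)%N]size_degseq => jl.
  rewrite eqn_mod_dvd; last exact: ltnW (degseq_ltn _ _ _ par ij jl).
  by apply/negP/Vdm_ndvd.
move=> i j E; case: (ltngtP i j) => [h|h|/val_inj //].
  by case: (key i j h E).
by case: (key j i h (esym E)).
Qed.

(** * The right-most slope as a maximum *)

Lemma foldr_max_le (b x : rat) (L : seq rat) : x <= b -> {in L, forall y, y <= b} ->
  foldr Num.max x L <= b.
Proof.
move=> xb; elim: L => //= y L IH h; rewrite ge_max h ?mem_head //=.
by apply: IH => z zL; apply: h; rewrite in_cons zL orbT.
Qed.

Lemma foldr_max_lt (b x : rat) (L : seq rat) : x < b -> {in L, forall y, y < b} ->
  foldr Num.max x L < b.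
Proof.
move=> xb; elim: L => //= y L IH h; rewrite gt_max h ?mem_head //=.
by apply: IH => z zL; apply: h; rewrite in_cons zL orbT.
Qed.

Lemma foldr_max_ge (x y : rat) (L : seq rat) : y \in L -> y <= foldr Num.max x L.
Proof.
elim: L => //= z L IH; rewrite in_cons le_max => /orP[/eqP->|/IH->].
  by rewrite lexx.
by rewrite orbT.
Qed.

Lemma NPslope_le (p : nat) (q : {poly rat}) (b : rat) : 0 <= b ->
  (forall k, (0 < k)%N -> q`_k != 0 -> (nu p q`_0 - nu p q`_k)%:~R / k%:R <= b) ->
  NPslope p q <= b.
Proof.
move=> b0 h; have hL : {in NPslopes p q, forall y, y <= b}.
  by move=> y /mapP[k]; rewrite mem_filter mem_iota => /andP[qk /andP[k0 _]] ->; apply: h.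
(* The seed of the fold is the first slope, or the default 0 if there is none; [0 <= b] covers the
   latter. *)
apply: foldr_max_le => //; case: (NPslopes p q) hL => //= y L; apply; exact: mem_head.
Qed.

Lemma NPslope_lt (p : nat) (q : {poly rat}) (b : rat) : 0 < b ->
  (forall k, (0 < k)%N -> q`_k != 0 -> (nu p q`_0 - nu p q`_k)%:~R / k%:R < b) ->
  NPslope p q < b.
Proof.
move=> b0 h; have hL : {in NPslopes p q, forall y, y < b}.
  by move=> y /mapP[k]; rewrite mem_filter mem_iota => /andP[qk /andP[k0 _]] ->; apply: h.
apply: foldr_max_lt => //; case: (NPslopes p q) hL => //= y L; apply; exact: mem_head.
Qed.

Lemma NPslope_ge (p k : nat) (q : {poly rat}) : (0 < k)%N -> q`_k != 0 ->
  (nu p q`_0 - nu p q`_k)%:~R / k%:R <= NPslope p q.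
Proof.
move=> k0 qk; apply: foldr_max_ge; apply/mapP; exists k => //.
rewrite mem_filter qk mem_iota k0 /=.
have : (k < size q)%N by rewrite ltnNge; apply: contraNN qk => /(nth_default 0) ->.
by case: (size q).
Qed.

Section Slopes.

Variables (lam : seq nat) (p E : nat).
Hypotheses (par : is_partition lam) (pp : prime p) (op : odd p).
Hypothesis pD : ~~ (p %| Delta lam)%N.
Hypothesis hE : core_sum (degseq lam) = ('C(size lam, 2) + E)%N.

Let r := size (degseq lam).
Let n (j : 'I_r) := nth 0%N (degseq lam) j.
Let W := hermite_wronskian r n.

Let hE' : core_sum (codom n) = ('C(r, 2) + E)%N.
Proof. by rewrite codom_nth hE /r size_degseq. Qed.

Let D0 : (Delta lam)%:R != 0 :> rat.
Proof. by rewrite pnatr_eq0; apply: contraNneq pD => ->; rewrite dvdn0. Qed.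

Let low := hermite_wronskian_low_nu p r E n pp op (Delta_nmod p lam par pp pD) hE'.

(** The power of [X] removed is exactly the core size [E]: lower coefficients vanish by
    [hermite_wronskian_below], and the one at [E] is nonzero by [low]. *)
Lemma coef_Rpoly (k : nat) : (Rpoly lam)`_k = (Delta lam)%:R^-1 * W`_(E + k).
Proof.
rewrite /Rpoly coef_drop_poly (xvalE _ E).
- by rewrite coef_HeW addnC.
- by rewrite coef_HeW mulf_neq0 ?invr_eq0 // low.1.
- move=> i iE; rewrite coef_HeW hermite_wronskian_below ?mulr0 // -/n hE' ltn_add2l //.
Qed.

Lemma coef_Rpoly_neq0 (k : nat) : (Rpoly lam)`_k != 0 -> W`_(E + k) != 0.
Proof. by rewrite coef_Rpoly; apply: contraNneq => ->; rewrite mulr0. Qed.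

Lemma nu_Rpoly (k : nat) : (Rpoly lam)`_k != 0 ->
  nu p (Rpoly lam)`_k = nu p W`_(E + k).
Proof.
move=> h; rewrite coef_Rpoly nuM ?invr_eq0 ?coef_Rpoly_neq0 //.
rewrite nuV // nu_nat; last by rewrite lt0n -(pnatr_eq0 rat).
by rewrite lognE (negPf pD) !andbF oppr0 add0r.
Qed.

Lemma Rpoly0_neq0 : (Rpoly lam)`_0 != 0.
Proof. by rewrite coef_Rpoly addn0 mulf_neq0 ?invr_eq0 // low.1. Qed.

(** Here [s] is the beta-set of the 2-core, known to callers only through its properties. The exact
    value, with the valuation of the units as first term, serves the extremal examples. *)
Lemma nu_Rpoly0 : exists2 s : seq nat,
  [/\ uniq s, size s = size lam, core_sum s = core_sum (degseq lam) &
      \sum_(x <- s) x = core_sum s]%N &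
  nu p (Rpoly lam)`_0 =
  (\sum_(x <- degseq lam) logn p (oddfact x))%:Z - (logn p (hook_prod s))%:Z.
Proof.
have cn : codom n = degseq lam by exact: codom_nth.
have cs : core_sum (codom n) = core_sum (degseq lam) by rewrite cn.
have sl : (\sum_(x <- degseq lam) logn p (oddfact x) = \sum_j logn p (oddfact (n j)))%N.
  by have := big_codom _ _ addn r n xpredT (fun x => logn p (oddfact x)); rewrite cn.
exists (codom (core_nth r n)).
  rewrite codom_core_nth core_beta_uniq size_core_codom.
  set e := count (predC odd) _; set o := count odd _.
  have co : count odd (core_beta e o) = o.
    rewrite count_cat !count_map (eq_count (a2 := pred0)); last by move=> x /=; rewrite odd_double.
    rewrite count_pred0 (eq_count (a2 := predT)); last by move=> x /=; rewrite odd_double.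
    by rewrite count_predT size_iota.
  have ce : count (predC odd) (core_beta e o) = e.
    have := count_predC odd (core_beta e o); rewrite size_core_beta co.
    by move/eqP; rewrite [(e + o)%N]addnC eqn_add2l => /eqP.
  have cb : core_sum (core_beta e o) = core_sum (codom n) by rewrite /core_sum co ce.
  by split; rewrite ?sum_core_beta ?cb ?cs //; exact: size_degseq.
rewrite nu_Rpoly ?Rpoly0_neq0 // addn0 low.2; congr (_ - _).
rewrite nu_prod => [|j]; last exact: herm_unit_neq0.
rewrite sl.
have -> : forall I : finType, forall F : I -> nat, (\sum_i F i)%:Z = \sum_i (F i)%:Z.
  by move=> I F; rewrite -natz natr_sum; apply: eq_bigr => i _; rewrite natz.
apply: eq_bigr => j _; rewrite -nu_norm normrM normrX normrN1 expr1n mul1r normr_nat.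
by rewrite nu_nat // oddfact_gt0.
Qed.

(** The valuation of the units is an upper bound for that of the constant term, and lowered by [V] a
    lower bound for the other; it cancels in the difference. *)
Lemma nu_Rpoly_drop (k V : nat) : (Rpoly lam)`_k != 0 ->
  (forall s : seq nat, uniq s -> size s = size lam -> core_sum s = core_sum (degseq lam) ->
     (\sum_(x <- s) x = 'C(size s, 2) + (E + k))%N -> (logn p (hook_prod s) <= V)%N) ->
  nu p (Rpoly lam)`_0 - nu p (Rpoly lam)`_k <= V%:Z.
Proof.
move=> hk hV; rewrite !nu_Rpoly ?Rpoly0_neq0 // addn0 low.2.
have := hermite_wronskian_nu_ge p r (E + k) V n pp _ (coef_Rpoly_neq0 k hk).
set L := logn p (hook_prod _); move=> H.
have : nu p (\prod_j herm_unit (n j)) - V%:Z <= nu p W`_(E + k).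
  apply: H => f fi fpar _ Ef; apply: hV.
  - by rewrite map_inj_uniq // enum_uniq.
  - by rewrite size_codom card_ord /r size_degseq.
  - by rewrite (core_sum_codom r f n fpar) codom_nth.
  - by rewrite sum_codom size_codom card_ord Ef.
lia.
Qed.

Lemma Rpoly_coef_bound (k : nat) : (Rpoly lam)`_k != 0 -> (E + k <= sumn lam)%N.
Proof.
move=> /coef_Rpoly_neq0 h; rewrite leqNgt; apply: contraNN h => h.
rewrite /W hermite_wronskian_above // -sum_codom codom_nth sum_degseq /r size_degseq.
by rewrite addnC ltn_add2l.
Qed.

End Slopes.

(** * Bounds and extremal examples *)

Lemma coef_Hen (n : nat) : (He n)`_n = 1.
Proof.
elim/ltn_ind: n => -[|[|n]] IH; rewrite ?/He /= ?coefC ?coefX //.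
rewrite -/(He n.+2) He_rec coefB coefXM coefZ IH //.
by rewrite [(He n)`_ _]nth_default ?mulr0 ?subr0 // (leq_trans (size_He n)).
Qed.

(** A contributing [f] satisfies [f j <= n j] for all [j], so equality of the sums forces [f = n],
    where all Hermite coefficients are 1. *)
Lemma hermite_wronskian_top (r E : nat) (n : 'I_r -> nat) :
  ('C(r, 2) + E = \sum_j n j)%N -> (hermite_wronskian r n)`_E = ffact_det r n.
Proof.
move=> hE; pose N := (\sum_j n j).+1.
have nle j : (n j < N)%N by rewrite ltnS (bigD1 j) //= leq_addr.
have nN j : (size (He (n j)) <= N)%N by apply: leq_trans (size_He _) _; apply: nle.
rewrite (coef_hermite_wronskian r N) // hE.
pose f0 : {ffun 'I_r -> 'I_N} := [ffun j => Ordinal (nle j)].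
have f0E j : f0 j = n j :> nat by rewrite ffunE.
rewrite (bigD1 f0) /=; last by apply/eqP/eq_bigr => j _; rewrite f0E.
rewrite [X in _ + X]big1 ?addr0 => [|f /andP[/eqP Ef ff]].
  rewrite big1 ?mul1r => [|j _]; last by rewrite f0E coef_Hen.
  by congr (\det _); apply/matrixP => i j; rewrite !mxE f0E.
apply/eqP/negPn/negP; rewrite mulf_eq0 negb_or => /andP[hA _].
have le j : (f j <= n j)%N.
  by have := hA; rewrite prodf_seq_neq0 => /allP/(_ j (mem_index_enum _))/coef_He_neq0[].
case/negP: ff; apply/eqP/ffunP => j; apply/val_inj; rewrite /= f0E.
apply/eqP; rewrite eqn_leq le /= leqNgt; apply/negP => lt.
have : (\sum_j f j < \sum_j n j)%N.
  rewrite (bigD1 j) //= [X in (_ < X)%N](bigD1 j) //= -addSn leq_add //.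
  by apply: leq_sum.
by rewrite Ef ltnn.
Qed.

Lemma ffact_det_Vdm (s : seq nat) :
  (forall i j, i < j -> j < size s -> nth 0 s i < nth 0 s j)%N ->
  ffact_det (size s) (fun j => nth 0%N s j) = (Vdm s)%:R.
Proof.
move=> inc; rewrite ffact_det_Vandermonde (exchange_big_dep xpredT) //= /Vdm natr_prod.
apply: eq_bigr => j _; rewrite natr_prod.
rewrite (big_ord_widen _ (fun i => (nth 0 s j - nth 0 s i)%N%:R : rat) (ltnW (ltn_ord j))).
by apply: eq_bigr => i ij; rewrite natrB // ltnW // inc.
Qed.

Section TopSlope.

Variables (lam : seq nat) (p E k : nat).
Hypotheses (par : is_partition lam) (pp : prime p) (op : odd p).
Hypothesis pD : ~~ (p %| Delta lam)%N.
Hypothesis hE : core_sum (degseq lam) = ('C(size lam, 2) + E)%N.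
Hypotheses (hk : sumn lam = (E + k)%N) (k0 : (0 < k)%N).

Lemma coef_Rpoly_top : (Rpoly lam)`_k = 1.
Proof.
have D0 : (Delta lam)%:R != 0 :> rat.
  by rewrite pnatr_eq0; apply: contraNneq pD => ->; rewrite dvdn0.
rewrite (coef_Rpoly lam p E) // hermite_wronskian_top.
  rewrite ffact_det_Vdm ?mulVf // => i j ij js; apply: degseq_ltn => //.
  by rewrite -size_degseq.
by rewrite -sum_codom codom_nth sum_degseq hk size_degseq addnC.
Qed.

(** The leading coefficient 1 is a point of valuation 0 at horizontal distance [k] from the right
    end. If the hook product of the core is prime to [p], the height of that end is the valuation of
    the units. *)
Lemma NPslope_ge_top (v : nat) :
  (forall s : seq nat, uniq s -> size s = size lam ->
     core_sum s = core_sum (degseq lam) ->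
     (\sum_(x <- s) x = core_sum s)%N -> logn p (hook_prod s) = 0%N) ->
  (v <= \sum_(x <- degseq lam) logn p (oddfact x))%N ->
  v%:R / k%:R <= NPslope p (Rpoly lam).
Proof.
move=> hL hv; have tk := coef_Rpoly_top.
have := NPslope_ge p k (Rpoly lam) k0; rewrite tk oner_eq0 => /(_ isT).
apply: le_trans; rewrite ler_pM2r ?invr_gt0 ?ltr0n //.
have [s [us ss cs sE] ->] := nu_Rpoly0 lam p E par pp op pD hE.
by rewrite (hL s) // nu1 !subr0 -[v%:R]/(v%:~R) ler_int.
Qed.

End TopSlope.

Lemma oddfact_logn (p n : nat) : prime p -> odd p -> (p <= n)%N ->
  (0 < logn p (oddfact n))%N.
Proof.
move=> pp op pn; rewrite logn_gt0 mem_primes pp oddfact_gt0 /=.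
rewrite -ltnS in pn; rewrite /oddfact (bigD1 (Ordinal pn)) //=; exact: dvdn_mulr.
Qed.

Lemma Vdm_ndvd_small (p : nat) (s : seq nat) : prime p ->
  (forall i j, i < j -> j < size s -> 0 < nth 0 s j - nth 0 s i < p)%N ->
  ~~ (p %| Vdm s)%N.
Proof.
move=> pp h; apply: Euclid_ndvd_prod => // j; apply: Euclid_ndvd_prod => // i.
by case/andP: (h i j (ltn_ord i) (ltn_ord j)) => h1 h2; rewrite gtnNdvd.
Qed.

(** Replaces the inductive description of the 2-core by parity counts of the degree sequence. *)
Lemma core2_sizeE (lam : seq nat) (t : nat) : is_partition lam ->
  core2_size lam t <-> core_sum (degseq lam) = ('C(size lam, 2) + t)%N.
Proof.
move=> par; have us := degseq_uniq lam par; split.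
  by case=> C [hC <-]; rewrite (reaches2core_dsize _ _ hC us) size_degseq.
move=> hE; have [C hC] := reaches2core_exists _ us; exists C; split=> //.
by have := reaches2core_dsize _ _ hC us; rewrite hE size_degseq => /addnI ->.
Qed.

Lemma prime_gt2_odd (p : nat) : prime p -> (2 < p)%N -> odd p.
Proof. by move=> pp; case: (even_prime pp) => [->|]. Qed.

Lemma prime_gt_core (m p : nat) : prime p -> (maxn 2 (2 * m - 1) < p)%N -> (2 * m < p)%N.
Proof.
move=> pp p2; have op : odd p by apply: prime_gt2_odd => //; lia.
have [//|pm] := ltnP (2 * m) p; have Ep : p = (2 * m)%N by lia.
by move: op; rewrite Ep mul2n odd_double.
Qed.

Lemma NPslope_empty_core (lam : seq nat) (p : nat) : is_partition lam ->
  core2_size lam 0 -> prime p -> (2 < p)%N -> ~~ (p %| Delta lam)%N ->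
  NPslope p (Rpoly lam) < 1 / (p%:R - 1) /\
  ((sumn lam < p ^ 2)%N -> NPslope p (Rpoly lam) <= 1 / p%:R).
Proof.
move=> par /(core2_sizeE _ _ par) hE pp p2 pD; have op := prime_gt2_odd p pp p2.
have pr0 : 0 < p%:R :> rat by rewrite ltr0n; lia.
have p1E : p%:R - 1 = p.-1%:R :> rat by rewrite -subn1 natrB //; lia.
have pr1 : 0 < p.-1%:R :> rat by rewrite ltr0n; lia.
split=> [|small].
  rewrite p1E; apply: NPslope_lt => [|k k0 qk]; first by rewrite divr_gt0.
  (* Over the integers, the strict bound of [logn_hook_prod_lt] reads [p.-1] times the valuation is
     at most [k.-1], whence this choice of [V]. *)
  have := nu_Rpoly_drop lam p 0 par pp op pD hE k (k.-1 %/ p.-1) qk.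
  set d := _ - _ => hd; have {hd} : d <= (k.-1 %/ p.-1)%:Z.
    apply: hd => s us ss cs Es; rewrite leq_divRL; last by lia.
    by have := logn_hook_prod_lt p k s pp op us Es k0; rewrite mulnC; lia.
  have := leq_trunc_div k.-1 p.-1; move: (_ %/ _)%N => q hq; clearbody d => hd.
  rewrite ltr_pdivrMr ?ltr0n // mulrAC mul1r ltr_pdivlMr //.
  apply: (@le_lt_trans _ _ (q%:R * p.-1%:R)).
    by rewrite ler_pM2r // -[q%:R]/(q%:~R) ler_int.
  by rewrite -natrM ltr_nat; lia.
apply: NPslope_le => [|k k0 qk]; first by rewrite divr_ge0 ?ler01 // ltW.
(* The core being empty, [k] is at most the size of the partition, hence below [p ^ 2]. *)
have kn := Rpoly_coef_bound lam p 0 par pp op pD hE k qk.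
have := nu_Rpoly_drop lam p 0 par pp op pD hE k (k %/ p) qk.
set d := _ - _ => hd; have {hd} : d <= (k %/ p)%:Z.
  apply: hd => s us ss cs Es; rewrite leq_divRL; last by lia.
  have := logn_hook_prod_small p k s pp op us Es; rewrite mulnC; apply.
  exact: leq_ltn_trans kn small.
have := leq_trunc_div k p; move: (_ %/ _)%N => q hq; clearbody d => hd.
rewrite ler_pdivrMr ?ltr0n // mulrAC mul1r ler_pdivlMr //.
apply: (@le_trans _ _ (q%:R * p%:R)).
  by rewrite ler_pM2r // -[q%:R]/(q%:~R) ler_int.
by rewrite -natrM ler_nat.
Qed.

Lemma NPslope_core (lam : seq nat) (m p : nat) : is_partition lam ->
  core2_size lam 'C(m.+1, 2) -> prime p -> (maxn 2 (2 * m - 1) < p)%N ->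
  ~~ (p %| Delta lam)%N -> (0 < m)%N ->
  NPslope p (Rpoly lam) <= 1 / (p.+1 - 2 * m)%:R.
Proof.
move=> par /(core2_sizeE _ _ par) hE pp p2 pD m0.
have op : odd p by apply: prime_gt2_odd => //; lia.
have mp := prime_gt_core m p pp p2.
have pr0 : 0 < (p.+1 - 2 * m)%:R :> rat by rewrite ltr0n; lia.
apply: NPslope_le => [|k k0 qk]; first by rewrite divr_ge0 ?ler01 // ltW.
have := nu_Rpoly_drop lam p _ par pp op pD hE k (k %/ (p.+1 - 2 * m)) qk.
set d := _ - _ => hd; have {hd} : d <= (k %/ (p.+1 - 2 * m))%:Z.
  apply: hd => s us ss cs Es; rewrite leq_divRL; last by lia.
  rewrite mulnC; apply: logn_hook_prod_core => //; first by rewrite cs hE ss.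
  by rewrite Es cs hE ss addnA.
have := leq_trunc_div k (p.+1 - 2 * m); move: (p.+1 - 2 * m)%N pr0 => P pr0.
move: (_ %/ _)%N => q hq; clearbody d => hd.
rewrite ler_pdivrMr ?ltr0n // mulrAC mul1r ler_pdivlMr //.
apply: (@le_trans _ _ (q%:R * P%:R)).
  by rewrite ler_pM2r // -[q%:R]/(q%:~R) ler_int.
by rewrite -natrM ler_nat.
Qed.

Lemma NPslope_ge_pp (p : nat) : prime p -> (2 < p)%N ->
  exists lam : seq nat,
    [/\ is_partition lam, core2_size lam 0, ~~ (p %| Delta lam)%N &
        1 / p%:R <= NPslope p (Rpoly lam)].
Proof.
move=> pp p2; have op := prime_gt2_odd p pp p2; pose lam := [:: p; p]; exists lam.
have dE : degseq lam = [:: p; p.+1] by rewrite -[in RHS]addn1 -[X in X :: _]addn0.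
have par : is_partition lam by rewrite /is_partition /lam /= andbT; apply: leqnn.
have cE : core_sum (degseq lam) = ('C(size lam, 2) + 0)%N.
  by rewrite dE /core_sum /= op.
have pD : ~~ (p %| Delta lam)%N.
  apply: Vdm_ndvd_small => // i j ij; rewrite dE /=.
  by case: j ij => [|[|j]] //; case: i => [|i] //= _ _; rewrite subSnn; lia.
split=> //; first exact/(core2_sizeE _ _ par).
have k0 : (0 < 2 * p)%N by lia.
have hk : sumn lam = (0 + 2 * p)%N by rewrite /lam /=; lia.
(* Both [p] and [p.+1] contribute a factor [p] to the units, and the degree is [2 p]: the slope is
   at least [2 / (2 p)]. *)
have := NPslope_ge_top lam p 0 (2 * p) par pp op pD cE hk k0 2.
rewrite natrM invfM mulrA divff // => -> //.
- move=> s us ss cs Es; apply/eqP; rewrite -leqn0 -(leq_pmul2l (prime_gt0 pp)) muln0.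
  apply: (logn_hook_prod_small p 0) => //; last by rewrite expn_gt0 prime_gt0.
  by rewrite Es cs cE ss addn0.
- rewrite dE !big_cons big_nil addn0 -[2%N]/(1 + 1)%N leq_add //; exact: oddfact_logn.
Qed.

Lemma NPslope_ge_hook (m p : nat) : (0 < m)%N -> prime p -> (2 < p)%N -> (2 * m < p)%N ->
  exists lam : seq nat,
    [/\ is_partition lam, core2_size lam 'C(m.+1, 2), ~~ (p %| Delta lam)%N &
        1 / (p.+1 - 2 * m)%:R <= NPslope p (Rpoly lam)].
Proof.
case: m => // m _ pp p2 mp; have op := prime_gt2_odd p pp p2.
(* After the shift of [m] this is the partition [(p-m, m, ..., 1)]. Its [m.+1] degrees are all odd,
   so its 2-core is the staircase starting at [m.+1]. *)
pose lam := mkseq (fun i => if i == 0%N then p - m else m.+1 - i)%N m.+1; exists lam.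
have sl : size lam = m.+1 by rewrite size_mkseq.
have dE : degseq lam = rcons [seq i.*2.+1 | i <- iota 0 m] p.
  apply: (@eq_from_nth _ 0%N) => [|i]; rewrite size_degseq sl.
    by rewrite size_rcons size_map size_iota.
  move=> im; rewrite nth_degseq ?sl // nth_mkseq; last by lia.
  rewrite nth_rcons size_map size_iota; case: ltngtP => h.
  - by rewrite (nth_map 0%N) ?size_iota // nth_iota //; case: eqP; lia.
  - by lia.
  - by rewrite h subn1 subnn eqxx subnK //; lia.
have par : is_partition lam.
  apply/(sortedP 0%N) => i; rewrite sl => im; rewrite !nth_mkseq //; last by lia.
  by rewrite /geq /=; case: i im => [|i] im /=; lia.
have cE : core_sum (degseq lam) = ('C(size lam, 2) + 'C(m.+2, 2))%N.
  have co : count odd (degseq lam) = m.+1.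
    rewrite dE -cats1 count_cat count_map /= op (eq_count (a2 := predT)) => [|x /=].
      by rewrite count_predT size_iota; lia.
    by rewrite odd_double.
  have ce : count (predC odd) (degseq lam) = 0%N.
    by have := count_predC odd (degseq lam); rewrite co size_degseq sl; lia.
  rewrite /core_sum co ce sl -mulnn; have := mul2_bin2 m; have := mul2_bin2 m.+1; lia.
have pD : ~~ (p %| Delta lam)%N.
  apply: Vdm_ndvd_small => // i j ij; rewrite [size _]size_degseq sl => jm.
  rewrite dE !nth_rcons size_map size_iota.
  have im : (i < m)%N by lia.
  have nthE l : (l < m)%N -> nth 0%N [seq i.*2.+1 | i <- iota 0 m] l = l.*2.+1.
    by move=> lm; rewrite (nth_map 0%N) ?size_iota // nth_iota.
  rewrite im (nthE i im); case: (ltngtP j m) => h; [rewrite nthE //|..]; lia.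
split=> //; first exact/(core2_sizeE _ _ par).
have k0 : (0 < p.+1 - 2 * m.+1)%N by lia.
have hk : sumn lam = ('C(m.+2, 2) + (p.+1 - 2 * m.+1))%N.
  have := sum_degseq lam; rewrite sl dE -cats1 big_cat big_seq1 /=.
  have := sum_core_beta 0 m; rewrite /core_beta /= => ->.
  by rewrite -mulnn; have := mul2_bin2 m; have := mul2_bin2 m.+1; lia.
apply: (NPslope_ge_top lam p _ _ par pp op pD cE hk k0 1).
(* At [k = 0] the bound of [logn_hook_prod_core] says that the hook product of the core is prime to
   [p]. *)
- move=> s us ss cs Es; apply/eqP; rewrite -leqn0 -(leq_pmul2l k0) muln0.
  apply: (logn_hook_prod_core p m.+1 0) => //; first by rewrite cs cE ss.
  by rewrite Es addn0.
- by rewrite dE -cats1 big_cat big_seq1 /=; have := oddfact_logn p p pp op (leqnn p); lia.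
Qed.

Theorem mainTheorem4 :
  (forall (lam : seq nat) (n m p : nat),
      is_partition lam -> sumn lam = n ->
      core2_size lam 'C(m.+1, 2) ->
      prime p -> (maxn 2 (2 * m - 1) < p)%N -> ~~ (p %| Delta lam)%N ->
      (m = 0%N ->
         NPslope p (Rpoly lam) < 1 / (p%:R - 1) /\
         ((n < p ^ 2)%N -> NPslope p (Rpoly lam) <= 1 / p%:R)) /\
      ((1 <= m)%N ->
         NPslope p (Rpoly lam) <= 1 / (p%:R - (2 * m%:R - 1))))
  /\
  (forall m p : nat, (1 <= m)%N -> prime p -> (maxn 2 (2 * m - 1) < p)%N ->
     exists lam : seq nat,
       [/\ is_partition lam, core2_size lam 'C(m.+1, 2), ~~ (p %| Delta lam)%N &
           NPslope p (Rpoly lam) = 1 / (p%:R - (2 * m%:R - 1))])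
  /\
  (forall p : nat, prime p -> (3 <= p)%N ->
     exists lam : seq nat,
       [/\ is_partition lam, core2_size lam 0, ~~ (p %| Delta lam)%N &
           1 / p%:R <= NPslope p (Rpoly lam)]).
Proof.
have denE (m p : nat) : prime p -> (maxn 2 (2 * m - 1) < p)%N ->
    (2 * m < p)%N /\ p%:R - (2 * m%:R - 1) = (p.+1 - 2 * m)%:R :> rat.
  move=> pp p2; have mp := prime_gt_core m p pp p2.
  by split=> //; rewrite natrB ?natrM -?natr1; [ring | lia].
split; [|split].
- move=> lam n m p par <- hc pp p2 pD; split=> [m0|m1].
    by apply: NPslope_empty_core => //; [rewrite m0 in hc | lia].
  by have [_ ->] := denE m p pp p2; apply: NPslope_core.
- move=> m p m1 pp p2; have [mp ->] := denE m p pp p2.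
  have [|lam [par hc pD ge]] := NPslope_ge_hook m p m1 pp _ mp; first by lia.
  exists lam; split=> //; apply/le_anti/andP; split=> //.
  exact: NPslope_core.
- exact: NPslope_ge_pp.
Qed.
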